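(* Let $K$ be a field, let $k$ be a positive integer, and let $t$ be an integer with $0\le t\le d-1$. Let $\Delta$ be a $k$-$\mathrm{CM}_t$ complex over $K$ of dimension $d-1$. If $s$ is an integer with $0\le s\le d$ and $\Delta'$ is the $(d-s-1)$-skeleton of $\Delta$, then $\Delta'$ is $(k+s)$-$\mathrm{CM}_t$ over $K$.
   Context: Simplicial complexes are finite and contain the empty face $\varnothing$; the vertex set of $\Delta$ is $\{x:\{x\}\in\Delta\}$; $\#\sigma$ is the number of elements of a face $\sigma$, and $\dim\sigma=\#\sigma-1$ (so $\dim\{\varnothing\}=-1$). A complex is pure if all its facets have the same dimension. The $j$-skeleton of $\Delta$ is the subcomplex of all faces of dimension at most $j$. For $\sigma\in\Delta$, $\mathrm{lk}_\Delta(\sigma)=\{\tau\in\Delta : \tau\cup\sigma\in\Delta,\ \tau\cap\sigma=\varnothing\}$. A complex is Cohen-Macaulay over $K$ if its Stanley-Reisner ring over $K$ is Cohen-Macaulay; $\{\varnothing\}$ is Cohen-Macaulay. Definition: for an integer $t\ge 0$, a simplicial complex $\Delta$ is $\mathrm{CM}_t$ over $K$ if $\Delta$ is pure and $\mathrm{lk}_\Delta(\sigma)$ is Cohen-Macaulay over $K$ for every $\sigma\in\Delta$ with $\#\sigma\ge t$. For $W\subseteq V$ write $\Delta_{V\setminus W}=\{\sigma\in\Delta:\sigma\subseteq V\setminus W\}$. Definition: for a positive integer $k$, a simplicial complex $\Delta$ with vertex set $V$ is $k$-$\mathrm{CM}_t$ of dimension $r$ over $K$ if for every subset $W\subseteq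 V$ (including $\varnothing$) with $\#W<k$, the complex $\Delta_{V\setminus W}$ is $\mathrm{CM}_t$ over $K$ of dimension $r$; it is $k$-$\mathrm{CM}_t$ over $K$ if this holds for some $r$. For $\Delta'$, its own vertex set is used. *)

(* Defs.v *)
From HB Require Import structures.
From mathcomp Require Import all_boot all_order all_algebra.
From mathcomp Require Import ring_quotient mpoly.
From mathcomp Require boolp.

Set Implicit Arguments.
Unset Strict Implicit.
Unset Printing Implicit Defensive.

Import Order.TTheory GRing.Theory Num.Theory.
Local Open Scope ring_scope.

(* Ideals are boolean predicates, as in ring_quotient; by boolp.asbool every  *)
(* Prop-valued predicate is of this form, so quantifying over {pred R}        *)
(* really ranges over all ideals.  Note that idealr_closed I includes         *)
(* 1 \notin I, i.e. it says that I is a proper ideal.                         *)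
Section CohenMacaulayRings.

Variable R : comNzRingType.
Implicit Types (I P m : {pred R}) (s : seq R).

Definition prime_ideal P : Prop := idealr_closed P /\ prime_idealr_closed P.

Definition maximal_ideal m : Prop :=
  idealr_closed m /\
  forall J : {pred R}, idealr_closed J -> {subset m <= J} -> {subset J <= m}.

Definition in_span s (x : R) : Prop :=
  exists c : nat -> R, x = \sum_(i < size s) c i * s`_i.

Definition noetherian : Prop :=
  forall I, idealr_closed I -> exists s, forall x, x \in I <-> in_span s x.

Definition regular_sequence s : Prop :=
  ~ in_span s 1 /\
  forall i, (i < size s)%N ->
    forall x, in_span (take i s) (s`_i * x) -> in_span (take i s) x.

Definition regular_sequence_in I s : Prop :=
  regular_sequence s /\ {subset s <= I}.

Definition has_depth I (n : nat) : Prop :=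
  (exists2 s, regular_sequence_in I s & size s = n) /\
  (forall s, regular_sequence_in I s -> (size s <= n)%N).

Definition prime_chain_to P (n : nat) (c : nat -> {pred R}) : Prop :=
  [/\ forall i, (i <= n)%N -> prime_ideal (c i),
      forall i, (i < n)%N ->
        {subset c i <= c i.+1} /\ ~ {subset c i.+1 <= c i}
    & c n =i P].

Definition has_height P (n : nat) : Prop :=
  (exists c, prime_chain_to P n c) /\
  (forall l c, prime_chain_to P l c -> (l <= n)%N).

(* Eisenbud, Commutative Algebra, Section 18.2: a noetherian ring R is        *)
(* Cohen-Macaulay if depth(m, R) = codim(m) for every maximal ideal m.        *)
Definition cohen_macaulay_ring : Prop :=
  noetherian /\
  forall m, maximal_ideal m -> exists n, has_depth m n /\ has_height m n.

End CohenMacaulayRings.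

Section SimplicialComplexes.

Variable T : finType.
Implicit Types (D : {set {set T}}) (sigma tau U : {set T}).

(* The vertices may form a proper subset of the ambient type T.               *)
Definition simplicial_complex D : Prop :=
  set0 \in D /\
  forall sigma tau : {set T}, sigma \in D -> tau \subset sigma -> tau \in D.

Definition vertices D : {set T} := [set x | [set x] \in D].

Definition face_dim sigma : int := #|sigma|%:Z - 1.

Definition complex_dim D : int := (\max_(sigma in D) #|sigma|)%N%:Z - 1.

Definition facet D sigma : bool := maxset (fun tau => tau \in D) sigma.

Definition pure D : Prop :=
  forall F G, facet D F -> facet D G -> face_dim F = face_dim G.

Definition skeleton (j : int) D : {set {set T}} :=
  [set sigma in D | face_dim sigma <= j].

Definition link D sigma : {set {set T}} :=
  [set tau in D | (tau :|: sigma \in D) && (tau :&: sigma == set0)].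

Definition restriction D U : {set {set T}} := [set sigma in D | sigma \subset U].

End SimplicialComplexes.

Section StanleyReisner.

Variables (K : fieldType) (T : finType) (D : {set {set T}}).

Local Notation V := (vertices D).
Local Notation S := {mpoly K[#|V|]}.

Definition face_monomial (sigma : {set T}) : S :=
  \prod_(i < #|V| | enum_val i \in sigma) 'X_i.

(* The condition sigma != set0 is redundant when D is a complex, as set0 is   *)
(* then a face; it makes the ideal below proper for every family D.           *)
Definition nonface (sigma : {set T}) : bool :=
  [&& sigma \subset V, sigma \notin D & sigma != set0].

Definition sr_ideal : {pred S} := fun p =>
  boolp.asbool (exists c : {set T} -> S,
    p = \sum_(sigma | nonface sigma) c sigma * face_monomial sigma).

Lemma sr_ideal_closed : idealr_closed sr_ideal.
Proof.
split.
- apply/boolp.asboolP; exists (fun=> 0).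
  by rewrite big1 // => sigma _; rewrite mul0r.
- apply/negP => /boolp.asboolP [c] /(congr1 (meval (fun=> 0))).
  rewrite raddf_sum big1 /= => [|sigma /and3P[sV _ /set0Pn[x xs]]].
    by rewrite rmorph1 => /eqP; rewrite oner_eq0.
  have xV := subsetP sV x xs.
  rewrite rmorphM rmorph_prod /= (bigD1 (enum_rank_in xV x)) /=.
    by rewrite mevalXU mul0r mulr0.
  by rewrite enum_rankK_in.
- move=> a u v /boolp.asboolP [c ->] /boolp.asboolP [c' ->].
  apply/boolp.asboolP; exists (fun sigma => a * c sigma + c' sigma).
  rewrite mulr_sumr -big_split /=; apply: eq_bigr => sigma _.
  by rewrite mulrDl mulrA.
Qed.

HB.instance Definition _ := isIdealr.Build S sr_ideal sr_ideal_closed.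

Definition stanley_reisner_ring : comNzRingType := {ideal_quot sr_ideal}.

Definition cohen_macaulay : Prop := cohen_macaulay_ring stanley_reisner_ring.

End StanleyReisner.

Section CMt.

Variables (K : fieldType) (T : finType).
Implicit Types D : {set {set T}}.

Definition CMt (t : nat) D : Prop :=
  [/\ simplicial_complex D, pure D
    & forall sigma, sigma \in D -> (t <= #|sigma|)%N ->
        cohen_macaulay K (link D sigma)].

Definition kCMt_of_dim (k t : nat) (r : int) D : Prop :=
  simplicial_complex D /\
  forall W : {set T}, W \subset vertices D -> (#|W| < k)%N ->
    CMt t (restriction D (vertices D :\: W)) /\
    complex_dim (restriction D (vertices D :\: W)) = r.

Definition kCMt (k t : nat) D : Prop := exists r, kCMt_of_dim k t r D.

End CMt.

(* Main.v *)
Require Import Defs.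
From HB Require Import structures.
From mathcomp Require Import all_boot all_order all_algebra.
From mathcomp Require Import ring_quotient mpoly ring zify.
From mathcomp Require boolp classical_sets.

(* Let S be the polynomial ring, I_D the ideal of the complex D, and call a list
   b acyclic modulo I_D if its Koszul homology with values in S/I_D vanishes in
   positive degrees. Purity and dimension are combinatorial, and links commute
   with skeleta and deletions, so the point is that if L is Cohen-Macaulay of
   dimension e - 1 then so is C, of dimension e - 2, the complex of the faces of L
   that have fewer than e vertices and avoid a given point x.

   Let y be the variable of x and E_i the sum of the squarefree monomials x^s with
   |s| = i, x not in s. The list b = (E_1^d_1, ..., E_{e-1}^d_{e-1}, y^e + E_e)
   generates an ideal whose radical in S/I_L is that of the origin. Depth = height
   at the origin gives a regular sequence of length e inside that radical, which
   forces b to be acyclic modulo I_L. Depth = height at the point where y = 1 and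
   the other variables vanish does the same for the star of x. Deleting x and then
   the facets with e vertices, one at a time, each time uses one short exact
   sequence 0 -> S/I_star -> S/I_D -> S/I_D' -> 0; since y^e + E_e lies in I_C,
   E_1^d_1, ..., E_{e-1}^d_{e-1} is acyclic modulo I_C for all exponents d_i.

   Conversely, by the Nullstellensatz a maximal ideal m of S/I_C contains monic
   polynomials g_i(E_i), with leading forms E_i^d_i; comparing leading forms, they
   are a regular sequence of length e - 1 in m. Regular sequences yield chains of
   primes, and chains have length at most e - 1 because any e elements of a
   polynomial ring in e - 1 variables are algebraically dependent; hence
   depth m = height m = e - 1. *)

Set Implicit Arguments.
Unset Strict Implicit.
Unset Printing Implicit Defensive.

Import GRing.Theory.

Local Open Scope ring_scope.

(** Two obstacles shape the proof: deleting a vertex or a facet does not by itself carry regular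
    sequences along, and Cohen-Macaulayness is tested at every maximal ideal. Against the first, the
    homological degree is the currency. An exact sequence costs one degree, so acyclicity from
    degree 1 on becomes acyclicity from degree 2 on; the cost does not accumulate over the
    deletions, because every star that is split off is again acyclic from degree 1 on. The
    additional parameter, acting as zero on S/I_C, pays the degree back. Against the second, the
    parameters are homogeneous and the exponents d_i stay free: the g_i vary with the maximal ideal,
    and no bound on their degrees is available in advance. One step lowers the dimension by one and
    removes at most one point; this is the trade in the theorem, where s skeleton steps absorb up to
    s further deletions. *)

Section Ideals.
Variable R : comNzRingType.
Implicit Types (V W : R -> Prop) (a b p q r : R) (l : seq R).

(** Properness is not demanded, in contrast with [idealr_closed]: the ideals occurring here may be
    the whole ring, for instance that of the star of a point that is no vertex. *)
Definition ideal V :=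
  [/\ V 0, forall p q, V p -> V q -> V (p + q) & forall r p, V p -> V (r * p)].

Lemma idealN V p : ideal V -> V p -> V (- p).
Proof. by case=> _ _ VM /(VM (-1)); rewrite mulN1r. Qed.

Lemma idealB V p q : ideal V -> V p -> V q -> V (p - q).
Proof. by move=> iV Vp Vq; case: (iV) => _ VD _; apply: VD => //; apply: idealN. Qed.

Lemma ideal_sum V I (s : seq I) (P : pred I) (F : I -> R) :
  ideal V -> (forall i, P i -> V (F i)) -> V (\sum_(i <- s | P i) F i).
Proof. by case=> V0 VD _ VF; elim/big_ind: _. Qed.

Definition ideal_add V a : R -> Prop := fun p => exists r, V (p - r * a).

Definition ideal_adds V l : R -> Prop := foldr (fun a W => ideal_add W a) V l.

Definition radical V : R -> Prop := fun a => exists N, V (a ^+ N).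

Definition regular_mod V a := forall p, V (a * p) -> V p.

Lemma ideal_addP V a : ideal V -> ideal (ideal_add V a).
Proof.
case=> V0 VD VM; split.
- by exists 0; rewrite mul0r subr0.
- move=> p q [r Vr] [t Vt]; exists (r + t).
  have -> : p + q - (r + t) * a = (p - r * a) + (q - t * a) by ring.
  exact: VD.
- move=> r p [t Vt]; exists (r * t).
  have -> : r * p - r * t * a = r * (p - t * a) by ring.
  exact: VM.
Qed.

Lemma sub_ideal_add V a p : V p -> ideal_add V a p.
Proof. by exists 0; rewrite mul0r subr0. Qed.

Lemma mem_ideal_add V a : ideal V -> ideal_add V a a.
Proof. by case=> V0 _ _; exists 1; rewrite mul1r subrr. Qed.

Lemma ideal_addsP V l : ideal V -> ideal (ideal_adds V l).
Proof. by move=> iV; elim: l => //= a l IH; apply: ideal_addP. Qed.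

Lemma sub_ideal_adds V l p : V p -> ideal_adds V l p.
Proof. by move=> Vp; elim: l => //= a l IH; apply: sub_ideal_add. Qed.

Lemma mem_ideal_adds V l a : ideal V -> a \in l -> ideal_adds V l a.
Proof.
move=> iV; elim: l => //= b l IH; rewrite inE => /orP[/eqP->|/IH].
  exact/mem_ideal_add/ideal_addsP.
exact: sub_ideal_add.
Qed.

Lemma ideal_add_mono V W a p : (forall q, V q -> W q) ->
  ideal_add V a p -> ideal_add W a p.
Proof. by move=> VW [r /VW]; exists r. Qed.

Lemma ideal_adds_mono V W l p : (forall q, V q -> W q) ->
  ideal_adds V l p -> ideal_adds W l p.
Proof. by move=> VW; elim: l p => /= [|a l IH] p; [exact: VW | exact: ideal_add_mono]. Qed.

Lemma ideal_adds_min V W l p : ideal W -> (forall q, V q -> W q) ->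
  (forall a, a \in l -> W a) -> ideal_adds V l p -> W p.
Proof.
move=> [W0 WD WM] VW; elim: l p => /= [|a l IH] p Wl; first exact: VW.
case=> r /IH H; rewrite -[p](subrK (r * a)); apply: WD.
  by apply: H => b bl; apply: Wl; rewrite inE bl orbT.
by apply: WM; apply: Wl; rewrite inE eqxx.
Qed.

Lemma radicalP V : ideal V -> ideal (radical V).
Proof.
move=> iV; case: (iV) => V0 VD VM; split.
- by exists 1; rewrite expr1.
- move=> p q [N VN] [M VqM]; exists (N + M)%N.
  rewrite exprDn; apply: ideal_sum => // i _; rewrite -mulr_natl; apply: (VM).
  case: (leqP M i) => Mi.
    by rewrite -(subnK Mi) exprD mulrA; apply: VM.
  by rewrite -addnBA ?(ltnW Mi) // exprD -mulrA mulrC; apply: VM.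
- by move=> r p [N VN]; exists N; rewrite exprMn; apply: VM.
Qed.

Lemma sub_radical V p : V p -> radical V p.
Proof. by exists 1; rewrite expr1. Qed.

Lemma radicalX V p k : radical V (p ^+ k) -> radical V p.
Proof. by case=> N; rewrite -exprM; exists (k * N)%N. Qed.

Lemma radical_mono V W p : (forall q, V q -> W q) -> radical V p -> radical W p.
Proof. by move=> VW [N /VW]; exists N. Qed.

End Ideals.

(** * Koszul complexes *)

Section Koszul.
Variable R : comNzRingType.
Implicit Types (V W : R -> Prop) (a b : R) (l : seq R).

(* The Koszul complex of b :: l is the mapping cone of b on the Koszul complex
   of l, so its chains are pairs; all homological degrees are kept together
   and a chain has degree i when it satisfies [deg]. *)
Fixpoint ch (n : nat) : lmodType R :=
  if n is n'.+1 then (ch n' * ch n')%type : lmodType R else R^o : lmodType R.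

(** Chains over R/V are represented by chains over R up to [chin V], so the ideal can vary while the
    complex stays the same. *)
Fixpoint chin (V : R -> Prop) (n : nat) : ch n -> Prop :=
  if n is n'.+1 then fun z => chin V z.1 /\ chin V z.2 else fun z => V z.

Fixpoint deg (n i : nat) : ch n -> Prop :=
  if n is n'.+1 then
    fun z => deg i z.1 /\ (if i is i'.+1 then deg i' z.2 else z.2 = 0)
  else fun z => i = 0 \/ z = 0.

(** [n] and [l] are independent, with missing entries read as 0, so that the recursion carries no
    size condition. *)
Fixpoint kd (n : nat) (l : seq R) : ch n -> ch n :=
  if n is n'.+1 then
    fun z => (kd (behead l) z.1 + head 0 l *: z.2, - kd (behead l) z.2)
  else fun=> 0.

(** Exterior multiplication by the vector with entries [c], just as [kd] is contraction against
    [l]. *)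
Fixpoint kh (n : nat) (c : seq R) : ch n -> ch n :=
  if n is n'.+1 then
    fun z => (kh (behead c) z.1, head 0 c *: z.1 - kh (behead c) z.2)
  else fun=> 0.

Lemma kd_linear n l : linear (@kd n l).
Proof.
elim: n l => [|n IH] l a /= u v; first by rewrite scaler0 addr0.
have I2 := IH (behead l) a u.2 v.2; have I1 := IH (behead l) a u.1 v.1.
rewrite I1 I2; congr pair.
  rewrite /= !scalerDr !scalerA [head 0 l * a]mulrC; rewrite !addrA; congr (_ + _).
  by rewrite -!addrA; congr (_ + _); rewrite addrC.
by rewrite /= opprD scalerN.
Qed.

Lemma kh_linear n c : linear (@kh n c).
Proof.
elim: n c => [|n IH] c a /= u v; first by rewrite scaler0 addr0.
have I2 := IH (behead c) a u.2 v.2; have I1 := IH (behead c) a u.1 v.1.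
rewrite I1 I2; congr pair.
rewrite /= !scalerDr !scalerA mulrC scalerN opprD !addrA; congr (_ + _).
by rewrite -!addrA; congr (_ + _); rewrite addrC.
Qed.

HB.instance Definition _ n l :=
  GRing.isLinear.Build R (ch n) (ch n) _ (@kd n l) (@kd_linear n l).

HB.instance Definition _ n c :=
  GRing.isLinear.Build R (ch n) (ch n) _ (@kh n c) (@kh_linear n c).

Lemma kd0 n l : kd l (0 : ch n) = 0. Proof. exact: raddf0. Qed.

Lemma kdB n l : {morph @kd n l : z w / z - w}. Proof. exact: raddfB. Qed.

Lemma kdN n l : {morph @kd n l : z / - z}. Proof. exact: raddfN. Qed.

Lemma kdZ n l a (z : ch n) : kd l (a *: z) = a *: kd l z.
Proof. exact: linearZ. Qed.

Section Chin.
Variables (V : R -> Prop) (iV : ideal V).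

Lemma chin0 n : chin V (0 : ch n).
Proof. by elim: n => [|n IH] /=; [case: iV | split]. Qed.

Lemma chinD n (z w : ch n) : chin V z -> chin V w -> chin V (z + w).
Proof.
elim: n z w => [|n IH] /= z w; first by case: iV => _ VD _; apply: VD.
by move=> [z1 z2] [w1 w2]; split; apply: IH.
Qed.

Lemma chinZ n r (z : ch n) : chin V z -> chin V (r *: z).
Proof.
elim: n z => [|n IH] /= z; first by case: iV => _ _; apply.
by move=> [z1 z2]; split; apply: IH.
Qed.

Lemma chinN n (z : ch n) : chin V z -> chin V (- z).
Proof. by rewrite -scaleN1r; apply: chinZ. Qed.

Lemma chinB n (z w : ch n) : chin V z -> chin V w -> chin V (z - w).
Proof. by move=> Vz Vw; apply: chinD => //; apply: chinN. Qed.

Lemma chin_kd n l (z : ch n) : chin V z -> chin V (kd l z).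
Proof.
elim: n l z => [|n IH] l /= z; first by case: iV.
by move=> [/[dup] z1 /IH dz1 /[dup] z2 /IH dz2]; split;
  [apply: chinD => //; apply: chinZ | apply: chinN].
Qed.

Lemma chin_kh n c (z : ch n) : chin V z -> chin V (kh c z).
Proof.
elim: n c z => [|n IH] c /= z; first by case: iV.
move=> [z1 z2]; split; first exact: IH.
by apply: chinB; [apply: chinZ | apply: IH].
Qed.

Lemma chinZ_mem n a (z : ch n) : V a -> chin V (a *: z).
Proof.
move=> Va; elim: n z => [|n IH] /= z; last by split; apply: IH.
by case: iV => _ _ VM; rewrite /GRing.scale /= mulrC; apply: VM.
Qed.

End Chin.

Lemma chin_mono V W n (z : ch n) : (forall p, V p -> W p) -> chin V z -> chin W z.
Proof. by move=> VW; elim: n z => [|n IH] /= z; [exact: VW | case; split; apply: IH]. Qed.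

Lemma chin_addP V a n (z w : ch n) : chin V (z - a *: w) -> chin (ideal_add V a) z.
Proof.
elim: n z w => [|n IH] /= z w; last by case=> /IH H1 /IH H2.
by rewrite /GRing.scale /= mulrC; exists w.
Qed.

Lemma deg0 n i : deg i (0 : ch n).
Proof. by elim: n i => [|n IH] [|i] /=; auto. Qed.

Lemma degZ n i r (z : ch n) : deg i z -> deg i (r *: z).
Proof.
elim: n i z => [|n IH] i /= z; first by case=> [->|->]; [left | right; rewrite scaler0].
case=> z1 z2; split; first exact: IH.
by case: i z2 {z1} => [->|i /IH//]; rewrite scaler0.
Qed.

Lemma degD n i (z w : ch n) : deg i z -> deg i w -> deg i (z + w).
Proof.
elim: n i z w => [|n IH] i /= z w.
  by case=> [->|->]; [left | case=> ->; [left | right; rewrite addr0]].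
move=> [z1 z2] [w1 w2]; split; first exact: IH.
by case: i z2 w2 {z1 w1} => [-> ->|i]; [rewrite addr0 | apply: IH].
Qed.

Lemma degN n i (z : ch n) : deg i z -> deg i (- z).
Proof. by rewrite -scaleN1r; apply: degZ. Qed.

Lemma degB n i (z w : ch n) : deg i z -> deg i w -> deg i (z - w).
Proof. by move=> Vz Vw; apply: degD => //; apply: degN. Qed.

Lemma chin_add V a n i (z : ch n) : ideal V -> deg i z ->
  chin (ideal_add V a) z -> exists2 w, deg i w & chin V (z - a *: w).
Proof.
move=> iV; elim: n i z => [|n IH] /= i z.
  case=> [->|->]; last by exists 0; [right | rewrite scaler0 subr0; case: iV].
  by case=> r Vr; exists r; [left | rewrite /GRing.scale /= mulrC].
move=> [/IH d1 d2] [/d1[w1 w1i V1] V2]; case: i d2 {d1} w1i => [|i] d2 w1i.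
  by exists (w1, 0) => //; split => //=; rewrite d2 scaler0 subr0; apply: chin0.
by have [w2 w2i V2'] := IH _ _ d2 V2; exists (w1, w2).
Qed.

Lemma deg_kd0 n l (z : ch n) : deg 0 z -> kd l z = 0.
Proof.
elim: n l z => [|n IH] l //= z [/IH-> ->].
by rewrite scaler0 addr0 raddf0 oppr0.
Qed.

Lemma deg_kd n l i (z : ch n) : deg i.+1 z -> deg i (kd l z).
Proof.
elim: n l i z => [|n IH] l i /= z; first by right.
case=> z1 z2; split; first by apply: degD; [apply: IH | apply: degZ].
case: i z2 {z1} => [/deg_kd0->|i]; [by rewrite oppr0 | by move=> z2; apply: degN; apply: IH].
Qed.

Lemma deg_kh n c i (z : ch n) : deg i z -> deg i.+1 (kh c z).
Proof.
elim: n c i z => [|n IH] c i /= z; first by right.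
case=> z1 z2; split; first exact: IH.
apply: degB; first exact: degZ.
case: i z2 {z1} => [->|i]; [by rewrite raddf0; apply: deg0 | exact: IH].
Qed.

Lemma deg_big n i (z : ch n) : (n < i)%N -> deg i z -> z = 0.
Proof.
elim: n i z => [|n IH] [|i] //= z; first by move=> _ [].
move=> li [z1 z2]; rewrite [z]surjective_pairing.
by rewrite (IH i.+1 _ _ z1) ?(IH i _ _ z2) // ltnW.
Qed.

Lemma kdd n l (z : ch n) : kd l (kd l z) = 0.
Proof.
elim: n l z => [|n IH] l //= z.
by rewrite [kd _ (- _)]raddfN [kd _ (_ + _)]raddfD /= !IH linearZ /= scalerN add0r subrr !oppr0.
Qed.

Fixpoint dotl n (l c : seq R) : R :=
  if n is n'.+1 then head 0 c * head 0 l + dotl n' (behead l) (behead c) else 0.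

(** Multiplication by an element of the ideal of [l] is null-homotopic, so this ideal annihilates
    Koszul homology. *)
Lemma kh_homotopy n l c (z : ch n) :
  kd l (kh c z) + kh c (kd l z) = dotl n l c *: z.
Proof.
elim: n l c z => [|n IH] l c /= z; first by rewrite addr0 scale0r.
case: z => u v /=; have I1 := IH (behead l) (behead c) u.
have I2 := IH (behead l) (behead c) v.
congr pair => /=; rewrite scalerDl.
  rewrite -I1 [kh _ (_ + _)]raddfD /= linearZ /= scalerBr scalerA [head 0 l * _]mulrC.
  by rewrite addrACA subrK addrC.
rewrite -I2 [kd _ (_ - _)]raddfB /= linearZ /= [kh _ (- _)]raddfN /= opprB opprK.
by rewrite scalerDr scalerA -addrA -(addrA (head 0 c *: kd _ u)) addKr addrCA.
Qed.

Lemma ideal_adds_dotl V l a : ideal_adds V l a -> exists c, V (a - dotl (size l) l c).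
Proof.
elim: l a => [|b l IH] /= a; first by exists [::]; rewrite subr0.
by case=> r /IH[c Vc]; exists (r :: c) => /=; rewrite opprD addrA.
Qed.

Definition acyclic V l j := forall i (z : ch (size l)), (j <= i)%N -> deg i z ->
  chin V (kd l z) -> exists2 w, deg i.+1 w & chin V (z - kd l w).

Lemma acyclic_size V l : ideal V -> acyclic V l (size l).+1.
Proof.
move=> iV i z li dz _; exists 0; first exact: deg0.
by rewrite (deg_big li dz) kd0 subr0; apply: chin0.
Qed.

Lemma acyclicW V l j k : (j <= k)%N -> acyclic V l j -> acyclic V l k.
Proof. by move=> jk H i z ki; apply: H; apply: leq_trans ki. Qed.

Lemma acyclic_eq V W l j : (forall p, V p <-> W p) -> acyclic V l j -> acyclic W l j.
Proof.
move=> VW H i z ji dz Wz; have [w dw Vw] := H i z ji dz (chin_mono (fun p => proj2 (VW p)) Wz).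
by exists w => //; apply: chin_mono Vw => p /VW.
Qed.

Lemma acyclic_top V l j : (forall p, V p) -> acyclic V l j.
Proof.
move=> VT i z _ _ _; exists 0; first exact: deg0.
by elim: (size l) (_ - _) => /=.
Qed.

(** In the long exact sequence of multiplication by a on R/V, the vanishing of H_(i+1) modulo V +
    (a) makes a injective on H_i; a power of a lies in V + (l) and kills H_i, so H_i = 0. *)
Lemma acyclic_regular V l a j : ideal V -> regular_mod V a ->
  radical (ideal_adds V l) a -> acyclic (ideal_add V a) l j.+1 -> acyclic V l j.
Proof.
move=> iV rega [N aN] ac i z ji dz Vz.
have rega' n (t : ch n) : chin V (a *: t) -> chin V t.
  by elim: n t => [|n IH] /= t; [exact: rega | case; split; apply: IH].
have {aN} aNz : exists2 w, deg i.+1 w & chin V (a ^+ N *: z - kd l w).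
  have [c Vc] := ideal_adds_dotl aN; exists (kh c z); first exact: deg_kh.
  have /eqP := kh_homotopy l c z; rewrite eq_sym -subr_eq => /eqP <-.
  rewrite opprB addrCA -scalerBl; apply: chinD => //; first exact: chin_kh.
  exact: chinZ_mem.
(* If a^(N+1) z is the boundary of w modulo V, then w is a cycle modulo V + (a), hence w = d w' + a
   w'' modulo V; cancelling a shows that a^N z is the boundary of w''. *)
elim: N aNz => [|N IH] [w dw Vw]; first by exists w => //; rewrite expr0 scale1r in Vw.
apply: IH.
have [||w' dw' Vw'] := ac i.+1 w _ dw; first by [].
  apply: (@chin_addP _ _ _ _ (a ^+ N *: z)).
  by rewrite scalerA -exprS -opprB; apply: chinN.
have [|w'' dw'' Vw''] := chin_add (i := i.+1) iV _ Vw'.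
  by apply: degB => //; apply: deg_kd.
exists w'' => //; apply: rega'.
have := chinD iV Vw (chin_kd iV l Vw'').
by rewrite !kdB kdd subr0 kdZ addrA subrK exprS -scalerA -scalerBr.
Qed.

Fixpoint regular_list V s : Prop :=
  if s is a :: s' then regular_mod V a /\ regular_list (ideal_add V a) s' else True.

(** Each element of the regular sequence gains one degree, starting from the absence of chains above
    degree [size l]; a sequence as long as [l] yields j = 1. *)
Lemma acyclic_regular_list V l s j : ideal V -> regular_list V s ->
  (forall a, a \in s -> radical (ideal_adds V l) a) ->
  (j + size s = (size l).+1)%N -> acyclic V l j.
Proof.
move=> iV; elim: s V iV j => [|a s IH] V iV j /=.
  by move=> _ _; rewrite addn0 => ->; apply: acyclic_size.
move=> [rega regs] rads js; apply: acyclic_regular rega _ _ => //.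
  by apply: rads; rewrite mem_head.
apply: IH => //; [exact: ideal_addP | move=> b bs | by rewrite addSnnS].
apply: radical_mono (rads b _); last by rewrite inE bs orbT.
by move=> q; apply: ideal_adds_mono => p; apply: sub_ideal_add.
Qed.

(* The short exact sequence 0 -> R/(V : m) -> R/V -> R/(V + m) -> 0. *)
Lemma acyclic_add V l m j : ideal V -> acyclic V l j.+1 ->
  acyclic (fun p => V (m * p)) l j -> acyclic (ideal_add V m) l j.+1.
Proof.
move=> iV ac acm [//|i] z ji dz Vz.
have [t dt Vt] := chin_add iV (deg_kd l dz) Vz.
have colon n (s : ch n) : chin V (m *: s) <-> chin (fun p => V (m * p)) s.
  elim: n s => [|n IH] s //=.
  by split=> -[H1 H2]; split; apply/IH.
have [|s ds Vs] := acm i t ji dt.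
  apply/colon; have := chinN iV (chin_kd iV l Vt).
  by rewrite kdB kdd sub0r opprK kdZ.
have [|||w dw Vw] := ac i.+1 (z - m *: s); first by [].
- by apply: degB => //; apply: degZ.
- move/colon: Vs => Vs; have := chinD iV Vt Vs.
  by rewrite scalerBr addrA subrK kdB kdZ.
exists w => //; apply: (@chin_addP _ _ _ _ s).
by rewrite addrAC.
Qed.

(** An element of V acts as zero, so the homology of [h :: l] in degree i+1 is the sum of those of
    [l] in degrees i+1 and i. The second summand is reached through the chain (0, z). *)
Lemma acyclic_drop V l h j : ideal V -> V h ->
  acyclic V (h :: l) j.+1 -> acyclic V l j.
Proof.
move=> iV Vh ac i z ji dz Vz.
have [|||[w1 w2] /= [_ dw2] [_]] := ac i.+1 (0, z); first by [].
- by split => //; apply: deg0.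
- split; last exact: chinN.
  by rewrite /= kd0 add0r; apply: chinZ_mem.
by exists (- w2); [apply: degN | rewrite kdN].
Qed.

Lemma acyclic_cons V l h j : ideal V -> V h ->
  acyclic V l j -> acyclic V (h :: l) j.+1.
Proof.
move=> iV Vh ac [//|i] /= [z1 z2] ji [/= d1 d2] [/= V1 V2].
have [|||w1 dw1 Vw1] := ac i.+1 z1; [exact: ltnW | by [] | | ].
  have := chinB iV V1 (chinZ_mem iV z2 Vh).
  by rewrite addrK.
have [|||w2 dw2 Vw2] := ac i (- z2); [by [] | exact: degN | by rewrite kdN | ].
exists (w1, w2); first by [].
split => /=; first by rewrite opprD addrA; apply: chinB => //; apply: chinZ_mem.
have := chinN iV Vw2; rewrite opprB !opprK addrC; exact.
Qed.

Fixpoint chmap (f : R -> R) n : ch n -> ch n :=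
  if n is n'.+1 then fun z => (chmap f z.1, chmap f z.2) else f.

Lemma chmapB (f : {additive R -> R}) n (z w : ch n) :
  chmap f (z - w) = chmap f z - chmap f w.
Proof. by elim: n z w => [|n IH] z w /=; rewrite ?IH //; apply: raddfB. Qed.

Lemma chmap0 (f : {additive R -> R}) n : chmap f (0 : ch n) = 0.
Proof. by elim: n => [|n IH] /=; rewrite ?IH //; apply: raddf0. Qed.

Lemma chmapZ (f : {rmorphism R -> R}) a n (z : ch n) :
  chmap f (a *: z) = f a *: chmap f z.
Proof. by elim: n z => [|n IH] z /=; rewrite ?IH //; apply: rmorphM. Qed.

Lemma chmapN (f : {additive R -> R}) n (z : ch n) : chmap f (- z) = - chmap f z.
Proof. by rewrite -[- z]sub0r chmapB chmap0 sub0r. Qed.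

Lemma chmapD (f : {additive R -> R}) n (z w : ch n) :
  chmap f (z + w) = chmap f z + chmap f w.
Proof. by rewrite -[w]opprK chmapB chmapN !opprK. Qed.

Lemma chmap_kd (f : {rmorphism R -> R}) n l (z : ch n) :
  (forall b, b \in l -> f b = b) -> chmap f (kd l z) = kd l (chmap f z).
Proof.
elim: n l z => [|n IH] l z fl /=; first exact: rmorph0.
have fl' : forall c, c \in behead l -> f c = c by move=> c /mem_behead /fl.
rewrite chmapD chmapN chmapZ !IH //; congr (_ + _ *: _, _).
by case: l fl {fl'} => [|b l] fl /=; [rewrite rmorph0 | apply: fl; rewrite mem_head].
Qed.

Lemma deg_chmap (f : {additive R -> R}) n i (z : ch n) : deg i z -> deg i (chmap f z).
Proof.
elim: n i z => [|n IH] i z /=.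
  by case=> [|->]; [left | right; apply: raddf0].
by case=> /IH d1; case: i d1 => [|i] d1; [move=> ->; rewrite chmap0 | move/IH].
Qed.

Lemma chin_chmap (f : R -> R) V W n (z : ch n) :
  (forall p, V p -> W (f p)) -> chin V z -> chin W (chmap f z).
Proof. by move=> VW; elim: n z => [|n IH] z /=; [exact: VW | case=> /IH H1 /IH]. Qed.

End Koszul.

(** * Face ideals *)

Section FaceIdeals.
Variables (K : fieldType) (n : nat).
Local Notation S := {mpoly K[n]}.
Implicit Types (D : {set {set 'I_n}}) (s t : {set 'I_n}) (m : 'X_{1..n}) (p q : S).

Definition msupport m : {set 'I_n} := [set i | m i != 0%N].

(** The Stanley-Reisner ideal by coefficients instead of generators: sums with and colons by
    monomials become operations on D. The empty D gives the whole ring. *)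
Definition face_ideal D : S -> Prop :=
  fun p => forall m, msupport m \in D -> p@_m = 0.

Definition downward D := forall s t, s \in D -> t \subset s -> t \in D.

Definition star D s : {set {set 'I_n}} := [set t | t :|: s \in D].

Definition msquarefree s : 'X_{1..n} := [multinom (i \in s : nat) | i < n].

Definition xset s : S := 'X_[msquarefree s].

Lemma msupportD m1 m2 : msupport (m1 + m2) = msupport m1 :|: msupport m2.
Proof. by apply/setP => i; rewrite !inE mnmDE addn_eq0 negb_and. Qed.

Lemma msupport_squarefree s : msupport (msquarefree s) = s.
Proof. by apply/setP => i; rewrite inE mnmE; case: (i \in s). Qed.

Lemma msupportU i : msupport U_(i) = [set i].
Proof. by apply/setP => j; rewrite !inE mnm1E [i == j]eq_sym; case: (j == i). Qed.

Lemma msupport0 : msupport 0 = set0.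
Proof. by apply/setP => j; rewrite !inE mnm0E. Qed.

Lemma mdeg_squarefree s : mdeg (msquarefree s) = #|s|.
Proof.
rewrite mdegE -sum1_card [RHS]big_mkcond; apply: eq_bigr => i _.
by rewrite mnmE; case: (i \in s).
Qed.

Lemma xset1 i : xset [set i] = 'X_i.
Proof.
congr mpolyX; apply/mnmP => j; rewrite mnmE mnm1E inE eq_sym.
by case: eqP.
Qed.

Lemma xset_mem m s : s \subset msupport m -> exists q, 'X_[m] = q * xset s.
Proof.
move=> sm; exists 'X_[m - msquarefree s]; rewrite -mpolyXD; congr mpolyX.
apply/mnmP => i; rewrite mnmDE mnmBE mnmE subnK //.
case: (boolP (i \in s)) => // /(subsetP sm); rewrite inE.
by case: (m i).
Qed.

Lemma face_idealP D : downward D -> ideal (face_ideal D).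
Proof.
move=> dD; split=> [m _|p q pD qD m mD|r p pD m mD]; first exact: mcoeff0.
  by rewrite mcoeffD pD // qD // addr0.
rewrite mcoeffM big1 // => -[k1 k2] /= /eqP e.
rewrite [p@__]pD ?mulr0 //; apply: dD mD _.
by have -> := congr1 msupport e; rewrite msupportD subsetUr.
Qed.

Lemma face_idealX D m : face_ideal D 'X_[m] <-> msupport m \notin D.
Proof.
split=> [H|nm k kD].
  apply/negP => /H; rewrite mcoeffX eqxx => /eqP; rewrite oner_eq0 //.
by rewrite mcoeffX; case: eqP nm => // ->; rewrite kD.
Qed.

Lemma face_ideal_xset D s : face_ideal D (xset s) <-> s \notin D.
Proof. by rewrite face_idealX msupport_squarefree. Qed.

Lemma ideal_monomials (V : S -> Prop) p : ideal V ->
  (forall m, m \in msupp p -> V 'X_[m]) -> V p.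
Proof.
move=> iV H; rewrite [p]mpolyE big_seq; apply: ideal_sum => // m mp.
by rewrite -mul_mpolyC; case: iV => _ _; apply; apply: H.
Qed.

Lemma face_ideal_subset D D' p : D' \subset D -> face_ideal D p -> face_ideal D' p.
Proof. by move=> /subsetP D'D H m /D'D; apply: H. Qed.

Lemma face_ideal_supp D p m : face_ideal D p -> m \in msupp p -> msupport m \notin D.
Proof. by move=> Dp; rewrite mcoeff_msupp; apply: contra => /Dp->. Qed.

Lemma downward_star D s : downward D -> downward (star D s).
Proof. by move=> dD t u; rewrite !inE => /dD H us; apply/H/setSU. Qed.

Lemma face_ideal_colon D m p : face_ideal D ('X_[m] * p) <-> face_ideal (star D (msupport m)) p.
Proof.
split=> H k.
  rewrite inE -msupportD => /H; by rewrite mulrC addmC mcoeffMX.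
move=> kD; case: (boolP (m <= k)%MM) => mk.
  rewrite -(submK mk) mulrC addmC mcoeffMX H // inE -msupportD submK //.
apply/eqP; rewrite mcoeff_eq0; apply: contra mk => /msuppM_le.
rewrite msuppX => /allpairsP[[a b]] /= [+ _ ->].
by rewrite inE => /eqP->; apply/mnm_lepP => i; rewrite mnmDE leq_addr.
Qed.

Definition deletion D s : {set {set 'I_n}} := [set t in D | ~~ (s \subset t)].

Lemma downward_deletion D s : downward D -> downward (deletion D s).
Proof.
move=> dD t u; rewrite !inE => /andP[tD st] ut; rewrite (dD t) //=.
by apply: contra st => /subset_trans; apply.
Qed.

(** With [face_ideal_colon] this turns the exact sequence behind [acyclic_add], for m = x^s, into
    that of the star of s, the complex and the deletion of s. *)
Lemma face_ideal_add D s p : downward D ->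
  ideal_add (face_ideal D) (xset s) p <-> face_ideal (deletion D s) p.
Proof.
move=> dD; have iD := face_idealP dD; split=> [[r Hr]|Hp].
  have iD' := face_idealP (@downward_deletion D s dD).
  rewrite -[p](subrK (r * xset s)); case: (iD') => _ VD VM; apply: VD.
    by apply: face_ideal_subset Hr; apply/subsetP => t; rewrite inE => /andP[].
  by apply: VM; apply/face_ideal_xset; rewrite inE subxx andbF.
apply: ideal_monomials; first exact: ideal_addP.
move=> m /(face_ideal_supp Hp); rewrite inE negb_and negbK => /orP[mD|].
  by apply/sub_ideal_add/face_idealX.
move=> /xset_mem[q ->]; case: (ideal_addP (xset s) iD) => _ _; apply.
exact: mem_ideal_add.
Qed.

End FaceIdeals.

(** * Graded bookkeeping *)

Section DegreeZero.
Variable R : comNzRingType.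
Implicit Types (V : R -> Prop) (l : seq R).

Fixpoint scalar_chain N (p : R) : ch R N :=
  if N is N'.+1 then (scalar_chain N' p, 0) else p.

Lemma deg_scalar_chain N p : deg 0 (scalar_chain N p).
Proof. by elim: N => [|N IH] /=; [left | split]. Qed.

Lemma scalar_chainZ N a p : scalar_chain N (a * p) = a *: scalar_chain N p.
Proof. by elim: N => [|N IH] //=; rewrite IH; congr pair; rewrite /= scaler0. Qed.

Lemma scalar_chainB N a b : scalar_chain N (a - b) = scalar_chain N a - scalar_chain N b.
Proof. by elim: N => [|N IH] //=; rewrite IH; congr pair; rewrite /= subr0. Qed.

(** H_0 of the Koszul complex is R/(V + (l)), so membership in the ideal can be traded for a
    boundary. *)
Lemma ideal_adds_chain V l a : ideal V ->
  ideal_adds V l a <-> exists2 u, deg 1 u & chin V (scalar_chain (size l) a - kd l u).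
Proof.
move=> iV; elim: l a => [|b l IH] a /=.
  split=> [Va|[u _]]; last by rewrite subr0.
  by exists 0; [right | rewrite subr0].
split=> [[r /IH[u du Vu]]|[[u v] /= [du dv] [Vu _]]].
  exists (u, scalar_chain _ r); first by split => //; apply: deg_scalar_chain.
  split; last by rewrite /= (deg_kd0 _ (deg_scalar_chain _ _)) oppr0 subr0; apply: chin0.
  move: Vu; rewrite /= [b *: _](_ : _ = scalar_chain (size l) (r * b)); last first.
    by rewrite mulrC scalar_chainZ.
  by rewrite scalar_chainB opprD addrA addrAC.
have [r rv] : exists r, v = scalar_chain (size l) r.
  elim: (size l) v dv {u du Vu IH} => [|N IHN] v /=.
    by move=> _; exists v.
  by case: v => v1 v2 /= [/IHN[r ->] ->]; exists r.
exists r; apply/IH; exists u => //; move: Vu; rewrite rv -scalar_chainZ mulrC.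
by rewrite scalar_chainB opprD addrA addrAC.
Qed.

End DegreeZero.

Section Graded.
Variables (K : fieldType) (n : nat).
Local Notation S := {mpoly K[n]}.
Local Notation comp k := (pihomog [measure of mdeg] k).
Implicit Types (p q : S) (ds : seq nat) (fs Fs : seq S).

Lemma mcoeff_comp k p m : (comp k p)@_m = if mdeg m == k then p@_m else 0.
Proof.
elim/mpolyind: p => [|c m' p _ _ IH]; first by rewrite raddf0 mcoeff0 if_same.
rewrite linearP /= !mcoeffD !mcoeffZ IH pihomogX /= (fun_if (mcoeff m)) mcoeff0 mcoeffX.
have [->|_] := eqVneq m' m; first by case: ifP => _; rewrite ?mulr0 ?addr0.
by rewrite !if_same mulr0 !add0r.
Qed.

Lemma msize_leP k p : (msize p <= k)%N <-> forall m, (k <= mdeg m)%N -> p@_m = 0.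
Proof.
split=> [pk m km|H].
  by apply/eqP; rewrite mcoeff_eq0; apply: msize_mdeg_ge; apply: leq_trans km.
rewrite msizeE; apply/bigmax_leqP_seq => m mp _; rewrite ltnNge.
by apply: contraL mp => /H p0; rewrite -mcoeff_eq0 p0.
Qed.

Lemma msize_sub_comp k p : (msize p <= k.+1)%N -> (msize (p - comp k p) <= k)%N.
Proof.
move/msize_leP => H; apply/msize_leP => m; rewrite leq_eqVlt eq_sym mcoeffB mcoeff_comp.
by case: eqP => [_|_ /= /H->]; rewrite ?subrr ?subr0.
Qed.

Lemma comp_small k p : (msize p <= k)%N -> comp k p = 0.
Proof.
move/msize_leP => H; apply/mpolyP => m; rewrite mcoeff_comp mcoeff0.
by case: eqP => // mk; rewrite H // mk.
Qed.

Lemma msize_comp k p : (msize (comp k p) <= k.+1)%N.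
Proof. by apply/msize_leP => m km; rewrite mcoeff_comp; case: eqP km => // ->; rewrite ltnn. Qed.

Lemma msizeM_leS h k p q : (msize p <= h.+1)%N -> (msize q <= k)%N -> (msize (p * q) <= h + k)%N.
Proof.
case: k => [|k] ph qk.
  have -> : q = 0 by apply/eqP; rewrite -msize_poly_eq0 -leqn0.
  by rewrite mulr0 msize0.
have [->|p0] := eqVneq p 0; first by rewrite mul0r msize0.
have [->|q0] := eqVneq q 0; first by rewrite mulr0 msize0.
rewrite msizeM //; move: (msize p) (msize q) ph qk => a b ha hb; lia.
Qed.

Lemma msize_add k p q : (msize p <= k)%N -> (msize q <= k)%N -> (msize (p + q) <= k)%N.
Proof.
by move=> /msize_leP Hp /msize_leP Hq; apply/msize_leP => m km; rewrite mcoeffD Hp ?Hq ?addr0.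
Qed.

Lemma comp_homogM h k p q : p \is h.-homog ->
  comp k (p * q) = if (h <= k)%N then p * comp (k - h) q else 0.
Proof.
move=> hp; elim/mpolyind: q => [|c m q _ _ IH].
  by rewrite mulr0 !raddf0 mulr0 if_same.
rewrite mulrDr -scalerAr [LHS]linearP [in RHS]linearP /= IH.
have -> : comp k (p * 'X_[m]) = if (h <= k)%N then p * comp (k - h) 'X_[m] else 0.
  have hpm : p * 'X_[m] \is (h + mdeg m).-homog by apply: dhomogM => //; rewrite dhomogX.
  rewrite pihomogX /=; case: (altP (h + mdeg m =P k)%N) => [<-|ne].
    by rewrite pihomog_dE // leq_addr addKn eqxx.
  rewrite (pihomog_ne0 ne) //; case: leqP => // hk.
  have [e|_] := eqVneq (mdeg m) (k - h)%N; last by rewrite mulr0.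
  by move: ne; rewrite e subnKC ?eqxx.
by case: leqP => _; rewrite ?scaler0 ?addr0 // mulrDr scalerAr.
Qed.

(** [msize] is the degree plus one, hence the successor. A form may be zero, and beyond the ends of
    the lists the default values meet the condition. *)
Definition leading ds fs Fs := forall i,
  (msize fs`_i <= (nth 0%N ds i).+1)%N /\ Fs`_i = comp (nth 0%N ds i) fs`_i.

Lemma leading_behead ds fs Fs :
  leading ds fs Fs -> leading (behead ds) (behead fs) (behead Fs).
Proof. by move=> H i; rewrite !nth_behead. Qed.

(* Total degree of a chain, where the generator attached to an element of
   degree h has degree h. *)
Fixpoint cle ds (k N : nat) : ch S N -> Prop :=
  if N is N'.+1 return ch S N -> Prop then
    fun z => cle (behead ds) k z.1 /\ cle (behead ds) (k - head 0%N ds) z.2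
  else fun z : S => (msize z <= k)%N.

(** [cle] bounds the degree strictly, so truncated subtraction is harmless there: bound 0 forces the
    chain 0. The component of exact degree k must be cut off explicitly when the generator has
    larger degree. *)
Fixpoint cpi ds (k N : nat) : ch S N -> ch S N :=
  if N is N'.+1 return ch S N -> ch S N then
    fun z => (cpi (behead ds) k z.1,
              if (head 0%N ds <= k)%N then cpi (behead ds) (k - head 0%N ds) z.2 else 0)
  else fun z : S => comp k z.

Lemma cle0P ds N (z : ch S N) : cle ds 0 z -> z = 0.
Proof.
elim: N ds z => [|N IH] ds z /=.
  by rewrite leqn0 msize_poly_eq0 => /eqP.
by rewrite [z]surjective_pairing sub0n => -[/IH/= -> /IH/= ->].
Qed.

Lemma cle0 ds k N : cle ds k (0 : ch S N).
Proof. by elim: N ds k => [|N IH] ds k /=; [rewrite msize0 | split]. Qed.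

Lemma cleD ds k N (z w : ch S N) : cle ds k z -> cle ds k w -> cle ds k (z + w).
Proof.
elim: N ds k z w => [|N IH] ds k z w /=; first exact: msize_add.
by move=> [z1 z2] [w1 w2]; split; apply: IH.
Qed.

Lemma cleN ds k N (z : ch S N) : cle ds k z -> cle ds k (- z).
Proof.
elim: N ds k z => [|N IH] ds k z /=; first by rewrite msizeN.
by move=> [z1 z2]; split; apply: IH.
Qed.

Lemma cleW ds k k' N (z : ch S N) : (k <= k')%N -> cle ds k z -> cle ds k' z.
Proof.
elim: N ds k k' z => [|N IH] ds k k' z /= kk'; first by move/leq_trans; apply.
by move=> [z1 z2]; split; [apply: IH z1 | apply: IH z2; rewrite leq_sub2r].
Qed.

Lemma cle_exists ds N (z : ch S N) : exists k, cle ds k z.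
Proof.
elim: N ds z => [|N IH] ds z /=; first by exists (msize z).
have [k1 z1] := IH (behead ds) z.1; have [k2 z2] := IH (behead ds) z.2.
exists (k1 + (head 0%N ds + k2))%N; split; first by apply: cleW z1; apply: leq_addr.
by apply: cleW z2; lia.
Qed.

Lemma cleZ ds h k N p (z : ch S N) : (msize p <= h.+1)%N -> cle ds k z -> cle ds (h + k) (p *: z).
Proof.
move=> ph; elim: N ds k z => [|N IH] ds k z /=; first exact: msizeM_leS.
move=> [z1 z2]; split; first exact: IH.
case: (leqP (head 0%N ds) k) => hk; first by rewrite -addnBA //; apply: IH.
move: z2; have /eqP-> : (k - head 0%N ds == 0)%N by rewrite subn_eq0 ltnW.
by move/cle0P->; rewrite scaler0; apply: cle0.
Qed.

Lemma cpiB ds k N : {morph @cpi ds k N : z w / z - w}.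
Proof.
elim: N ds k => [|N IH] ds k z w /=; first exact: raddfB.
by rewrite !IH; congr pair; case: ifP => //= _; rewrite subr0.
Qed.

Lemma cpi0 ds k N : cpi ds k (0 : ch S N) = 0.
Proof. by rewrite -[0 in LHS](subrr 0) cpiB subrr. Qed.

Lemma cpiN ds k N : {morph @cpi ds k N : z / - z}.
Proof. by move=> z; rewrite -sub0r cpiB cpi0 sub0r. Qed.

Lemma cpi_small ds k N (z : ch S N) : cle ds k z -> cpi ds k z = 0.
Proof.
elim: N ds k z => [|N IH] ds k z /=; first exact: comp_small.
by move=> [/IH-> /IH->]; rewrite if_same.
Qed.

Lemma cpi_id ds k N (z : ch S N) : cpi ds k (cpi ds k z) = cpi ds k z.
Proof.
elim: N ds k z => [|N IH] ds k z /=; first exact: pihomog_id.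
by rewrite IH; case: leqP => // _; rewrite IH.
Qed.

Lemma cle_cpi ds k N (z : ch S N) : cle ds k.+1 (cpi ds k z).
Proof.
elim: N ds k z => [|N IH] ds k z /=; first exact: msize_comp.
split=> //; case: leqP => hk; last exact: cle0.
by rewrite subSn.
Qed.

Lemma cle_sub_cpi ds k N (z : ch S N) : cle ds k.+1 z -> cle ds k (z - cpi ds k z).
Proof.
elim: N ds k z => [|N IH] ds k z /=; first exact: msize_sub_comp.
move=> [z1 z2]; split; first exact: IH.
rewrite /=; case: leqP z2 => hk; first by rewrite subSn //; apply: IH.
have /eqP-> : (k.+1 - head 0%N ds == 0)%N by rewrite subn_eq0.
by move/cle0P->; rewrite subr0; apply: cle0.
Qed.

Lemma deg_cpi ds k i N (z : ch S N) : deg i z -> deg i (cpi ds k z).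
Proof.
elim: N ds k i z => [|N IH] ds k i z /=.
  by case=> [->|->]; [left | right; apply: raddf0].
case=> z1 z2; split; first exact: IH.
case: ifP => _; last by case: i {z1 z2} => // i; apply: deg0.
by case: i z2 {z1} => [->|i z2]; [apply: cpi0 | apply: IH].
Qed.

Lemma cpiZ_homog ds h k N p (z : ch S N) : p \is h.-homog ->
  cpi ds k (p *: z) = if (h <= k)%N then p *: cpi ds (k - h) z else 0.
Proof.
move=> hp; elim: N ds k z => [|N IH] ds k z /=; first exact: comp_homogM.
rewrite !IH; case: (leqP h k) => hk.
  congr pair => /=; case: (leqP (head 0%N ds) k) => dk.
    have -> : (head 0%N ds <= k - h)%N = (h <= k - head 0%N ds)%N by lia.
    by case: leqP => _; rewrite ?scaler0 // subnAC.
  have -> : (head 0%N ds <= k - h)%N = false by lia.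
  by rewrite scaler0.
by congr pair; case: ifP => // _; rewrite leqNgt (leq_ltn_trans _ hk) ?leq_subr.
Qed.

Lemma cpi_kd ds k fs Fs N (z : ch S N) : leading ds fs Fs ->
  cpi ds k (kd Fs z) = kd Fs (cpi ds k z).
Proof.
elim: N ds fs Fs k z => [|N IH] ds fs Fs k z lead /=; first exact: raddf0.
have lead' := leading_behead lead.
have cpiD M (d : seq nat) j (w w' : ch S M) : cpi d j (w + w') = cpi d j w + cpi d j w'.
  by rewrite -[w']opprK cpiB cpiN !opprK.
have hF : head 0 Fs \is (head 0%N ds).-homog.
  by rewrite -!nth0 (lead 0).2; apply: pihomogP.
rewrite cpiD cpiN !(IH _ _ _ _ _ lead') (cpiZ_homog _ _ _ hF).
by case: ifP => _; rewrite ?scaler0 ?kd0 ?oppr0.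
Qed.

Lemma cle_kd_sub ds k fs Fs N (z : ch S N) : leading ds fs Fs ->
  cle ds k.+1 z -> cle ds k (kd fs z - kd Fs z).
Proof.
elim: N ds fs Fs k z => [|N IH] ds fs Fs k z lead /=; first by rewrite subr0 msize0.
have lead' := leading_behead lead; move=> [z1 z2]; split => /=.
  rewrite opprD addrACA -scalerBl; apply: cleD; first exact: IH.
  have [mf eF] := lead 0%N; rewrite -!nth0 eF.
  case: (leqP (nth 0%N ds 0) k) => hk.
    move: z2; rewrite subSn -?nth0 // => z2.
    have := msize_sub_comp mf; case E: (nth 0%N ds 0) => [|h] H.
      move: H; rewrite leqn0 msize_poly_eq0 => /eqP->.
      by rewrite scale0r; apply: cle0.
    have := cleZ H z2; rewrite E addnS -addSn subnKC //; lia.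
  have /cle0P-> : cle (behead ds) 0 z.2.
    by move: z2; have /eqP-> : (k.+1 - head 0%N ds == 0)%N by rewrite subn_eq0 -nth0.
  by rewrite scaler0; apply: cle0.
rewrite -opprD; apply: cleN.
case: (leqP (head 0%N ds) k) => hk; first by apply: IH => //; rewrite -subSn.
have /cle0P-> : cle (behead ds) 0 z.2.
  by move: z2; have /eqP-> : (k.+1 - head 0%N ds == 0)%N by rewrite subn_eq0.
by rewrite !kd0 subr0; apply: cle0.
Qed.

Section HomogeneousIdeal.
Variables (V : S -> Prop) (iV : ideal V).
Hypothesis homV : forall k p, V p -> V (comp k p).

Lemma chin_cpi ds k N (z : ch S N) : chin V z -> chin V (cpi ds k z).
Proof.
elim: N ds k z => [|N IH] ds k z /=; first exact: homV.
by move=> [z1 z2]; split; [apply: IH | case: ifP => _; [apply: IH | apply: chin0]].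
Qed.

Definition bounded_acyclic fs ds k N := forall z : ch S N, deg 1 z -> cle ds k z ->
  chin V (kd fs z) -> exists w, [/\ deg 2 w, cle ds k w & chin V (z - kd fs w)].

(** The top component of a cycle for [fs] is a cycle for the leading forms; subtracting the
    [fs]-boundary of a chain that bounds it lowers the degree. The bounding chain obeys the same
    degree bound, which later makes generators of high degree invisible. *)
Lemma leading_bounded_acyclic ds fs Fs k : leading ds fs Fs -> acyclic V Fs 1 ->
  bounded_acyclic fs ds k (size Fs).
Proof.
move=> lead ac; elim: k => [|k IH] z dz kz Vz.
  exists 0; split; [exact: deg0 | exact: cle0 |].
  by rewrite (cle0P kz) kd0 subr0; apply: chin0.
set z' := cpi ds k z.
have z'E : cpi ds k z' = z' by apply: cpi_id.
have Vz' : chin V (kd Fs z').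
  have := chin_cpi ds k Vz.
  rewrite (_ : kd fs z = (kd fs z - kd Fs z) - - kd Fs z); last by rewrite opprK subrK.
  rewrite cpiB.
  rewrite (cpi_small (cle_kd_sub lead kz)) sub0r cpiN opprK.
  by rewrite (cpi_kd _ _ lead).
have [//||u du Vu] := ac 1%N z' _ _ Vz'; first exact: deg_cpi.
set u' := cpi ds k u.
have Vu' : chin V (z' - kd Fs u').
  by have := chin_cpi ds k Vu; rewrite cpiB z'E (cpi_kd _ _ lead).
have du' : deg 2 u' by apply: deg_cpi.
(* This is z - kd fs u' up to a chain with coefficients in V, written so that both summands visibly
   have lower degree. *)
pose z1 := (z - z') + (kd Fs u' - kd fs u').
have zE : z - kd fs u' = z1 + (z' - kd Fs u').
  by rewrite /z1 addrACA subrK [_ - _ - _]addrAC subrr add0r.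
have [|||w1 [dw1 kw1 Vw1]] := IH z1.
- apply: degD; apply: degB => //; [exact: deg_cpi | exact: deg_kd | exact: deg_kd].
- apply: cleD; first exact: cle_sub_cpi.
  by rewrite -opprB; apply: cleN; apply: cle_kd_sub lead _; apply: cle_cpi.
- rewrite (_ : z1 = (z - kd fs u') - (z' - kd Fs u')); last by rewrite zE addrK.
  by rewrite kdB; apply: chinB => //; [rewrite kdB kdd subr0 | apply: chin_kd].
exists (u' + w1); split; first exact: degD.
  by apply: cleD; [apply: cle_cpi | apply: cleW kw1].
rewrite -[w1]opprK kdB opprB addrCA zE kdN addrA.
rewrite [- _ + _]addrC; exact: chinD.
Qed.

(** A generator of degree at least k does not occur in a chain of degree below k. *)
Lemma bounded_acyclic_drop f h fs ds k N : (k <= h)%N ->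
  bounded_acyclic (f :: fs) (h :: ds) k N.+1 -> bounded_acyclic fs ds k N.
Proof.
move=> kh ac z dz kz Vz.
have hk0 : (k - h = 0)%N by apply/eqP; rewrite subn_eq0.
have [|||[w1 w2] /= [[dw1 _] [kw1 +] [+ _]]] := ac (z, 0).
- by split => //; apply: deg0.
- by split => //; apply: cle0.
- by split; rewrite /= ?kd0 ?oppr0 ?scaler0 ?addr0 //; apply: chin0.
by rewrite hk0 /= => /cle0P-> /=; rewrite scaler0 addr0; exists w1.
Qed.

Lemma bounded_acyclic_catr fs' ds' fs ds k N : size fs' = size ds' ->
  (forall h, h \in ds' -> (k <= h)%N) ->
  bounded_acyclic (fs' ++ fs) (ds' ++ ds) k (size fs' + N) -> bounded_acyclic fs ds k N.
Proof.
elim: fs' ds' => [|f fs' IH] [|h ds'] //= [sz] hk ac; apply: (IH ds') => //.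
  by move=> h' h'd; apply: hk; rewrite inE h'd orbT.
by apply: bounded_acyclic_drop ac; apply: hk; rewrite mem_head.
Qed.

(** If f p lies in V + (fs), the relation is a 1-cycle (-u, p); the second component of a chain
    bounding it puts p in V + (fs). *)
Lemma bounded_acyclic_regular f fs h ds :
  (forall k, bounded_acyclic (f :: fs) (h :: ds) k (size fs).+1) ->
  regular_mod (ideal_adds V fs) f.
Proof.
move=> ac p /(ideal_adds_chain _ _ iV)[u du Vu]; apply/(ideal_adds_chain _ _ iV).
pose z : ch S (size fs).+1 := (- u, scalar_chain (size fs) p).
have [k kz] := cle_exists (h :: ds) z.
have [||w [dw _ Vw]] := ac k z _ kz.
- by split; [apply: degN | apply: deg_scalar_chain].
- split; rewrite /= ?kdN; last first.
    by rewrite (deg_kd0 _ (deg_scalar_chain _ _)) oppr0; apply: chin0.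
  by rewrite -scalar_chainZ addrC.
exists (- w.2); first by case: dw => _ /=; apply: degN.
by rewrite kdN; case: Vw.
Qed.

End HomogeneousIdeal.

End Graded.

(** * A system of parameters *)

Lemma regular_list_eq (R : comNzRingType) (V W : R -> Prop) s :
  (forall p, V p <-> W p) -> regular_list V s -> regular_list W s.
Proof.
elim: s V W => [//|a s IH] V W VW [ra rs]; split; first by move=> p /VW/ra/VW.
by apply: IH rs => p; split; apply: ideal_add_mono => q /VW.
Qed.

Section SystemOfParams.
Variables (K : fieldType) (n : nat).
Local Notation S := {mpoly K[n]}.
Implicit Types (D : {set {set 'I_n}}) (s t : {set 'I_n}) (m : 'X_{1..n}) (p q : S).

Lemma radical_point (W : S -> Prop) (pt : 'I_n -> K) p : ideal W ->
  (forall i, radical W ('X_i - (pt i)%:MP)) -> p.@[pt] = 0 -> radical W p.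
Proof.
move=> iW H p0; have iR := radicalP iW; case: (iR) => R0 RD RM.
suff : radical W (p - (p.@[pt])%:MP) by rewrite p0 subr0.
pose good (a : S) (c : K) := radical W (a - c%:MP).
have goodM a b c d : good a c -> good b d -> good (a * b) (c * d).
  rewrite /good => ga gb.
  have -> : a * b - (c * d)%:MP = b * (a - c%:MP) + c%:MP * (b - d%:MP).
    by rewrite mpolyCM; ring.
  by apply: RD; apply: RM.
have good1 : good 1 1 by rewrite /good mpolyC1 subrr.
rewrite -/(good _ _) {p0}; elim/mpolyind: p => [|c m p _ _ IH].
  by rewrite /good meval0 mpolyC0 subrr.
rewrite /good mevalD mevalZ mevalX mpolyCD mpolyCM -mul_mpolyC opprD addrACA.
apply: RD => //; rewrite -mulrBr; apply: RM; rewrite mpolyXE_id -/(good _ _).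
elim/big_ind2: _ => [|a c' b d|i _]; [exact: good1 | exact: goodM |].
by elim: (m i) => [|k IHk]; rewrite ?expr0 // !exprS; apply: goodM => //; apply: H.
Qed.

Section Point.
Variable x : 'I_n.

Definition elem (i : nat) : S :=
  \sum_(s : {set 'I_n} | (#|s| == i) && (x \notin s)) xset K s.

(** Descending induction on the size of s. The square of x^s is x^s E_|s| minus products x^s x^t
    with t of the same size, and these are divisible by the monomial of the larger set s :|: t. *)
Lemma radical_vars (W : S -> Prop) e : ideal W ->
  (forall i, (0 < i <= e)%N -> radical W (elem i)) ->
  (forall s, x \notin s -> (e < #|s|)%N -> radical W (xset K s)) ->
  forall v, v != x -> radical W 'X_v.
Proof.
move=> iW HE Hbig v vx; have iR := radicalP iW; case: (iR) => R0 RD RM.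
suff H j s : x \notin s -> (0 < #|s|)%N -> (e - j < #|s|)%N -> radical W (xset K s).
  rewrite -xset1; apply: (H e); rewrite ?cards1 ?inE 1?eq_sym //.
  by rewrite subnn.
elim: j s => [|j IH] s xs s0; first by rewrite subn0; apply: Hbig.
case: (ltnP (e - j) #|s|) => [lt _|sej ejs]; first exact: IH.
have sE : (0 < #|s| <= e)%N by apply/andP; split => //; lia.
apply: (@radicalX _ _ _ 2).
have -> : xset K s ^+ 2 = xset K s * elem #|s| -
    \sum_(t : {set 'I_n} | ((#|t| == #|s|) && (x \notin t)) && (t != s)) xset K s * xset K t.
  rewrite /elem (bigD1 s) /=; last by rewrite eqxx.
  by rewrite mulrDr mulr_sumr addrK.
apply: (idealB iR); first by apply: RM; apply: HE.
apply: ideal_sum => // t /andP[/andP[/eqP ts xt] nts].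
rewrite -mpolyXD.
have /(@xset_mem K)[q ->] : s :|: t \subset msupport (msquarefree s + msquarefree t).
  by rewrite msupportD !msupport_squarefree.
have lt : (#|s| < #|s :|: t|)%N.
  rewrite proper_card //; apply/properP; split; first exact: subsetUl.
  have /subsetPn[i it ns] : ~~ (t \subset s).
    by apply: contra nts => tss; rewrite eqEcard tss ts leqnn.
  by exists i => //; rewrite inE it orbT.
apply: RM; apply: IH; [by rewrite inE negb_or xs | exact: leq_trans lt | lia].
Qed.

Variables (e : nat) (d : nat -> nat).
Hypothesis e_gt0 : (0 < e)%N.

(** The indices decrease because the head of the list is the outermost generator of the mapping
    cone: elements of high index can then be dropped first. *)
Definition params := [seq elem i ^+ d i | i <- rev (iota 1 e.-1)].

(** One element in place of two: y E_e lies in I_L because faces have at most e vertices, so the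
    radical contains y and then E_e. This keeps the number of parameters equal to e. *)
Definition top_param : S := 'X_x ^+ e + elem e.

Lemma size_params (a : S) : size (a :: params) = e.
Proof. by rewrite /= size_map size_rev size_iota prednK. Qed.

Lemma radical_params (W : S -> Prop) : ideal W ->
  (forall a, a \in params -> W a) -> radical W (elem e) ->
  (forall s, x \notin s -> (e < #|s|)%N -> W (xset K s)) ->
  forall v, v != x -> radical W 'X_v.
Proof.
move=> iW Wp We Ws; apply: (radical_vars iW (e := e)) => [i|s xs es]; last first.
  exact/sub_radical/Ws.
move=> /andP[i0]; rewrite leq_eqVlt => /orP[/eqP-> //|ie].
apply/(radicalX (k := d i))/sub_radical/Wp/map_f.
by rewrite mem_rev mem_iota i0; lia.
Qed.

Section Complex.
Variable (L : {set {set 'I_n}}).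
Hypotheses (dL : downward L) (Le : forall s, s \in L -> (#|s| <= e)%N).

Lemma elem_top_notin D : (forall s, #|s| = e -> x \notin s -> s \notin D) ->
  face_ideal D (elem e).
Proof.
move=> H m mt; rewrite raddf_sum big1 // => s /andP[/eqP sE xs].
rewrite /= /xset mcoeffX; case: eqP => // sm; case/negP: (H _ sE xs).
by rewrite -(msupport_squarefree s) sm.
Qed.

Lemma notin_star s : #|s| = e -> x \notin s -> s \notin star L [set x].
Proof.
move=> sE xs; rewrite inE; apply/negP => /Le.
by rewrite setUC cardsU1 xs sE add1n ltnn.
Qed.

Lemma elem_top_star : face_ideal (star L [set x]) (elem e).
Proof. exact/elem_top_notin/notin_star. Qed.

Lemma X_elem_top : face_ideal L ('X_x * elem e).
Proof. by apply/face_ideal_colon; rewrite msupportU; apply: elem_top_star. Qed.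

Lemma xset_big s : (e < #|s|)%N -> face_ideal L (xset K s).
Proof. by move=> es; apply/face_ideal_xset; apply/negP => /Le; rewrite leqNgt es. Qed.

Lemma radical_origin (W : S -> Prop) i : ideal W ->
  (forall p, face_ideal L p -> W p) -> (forall b, b \in top_param :: params -> W b) ->
  radical W 'X_i.
Proof.
move=> iW LW Wp; have iR := radicalP iW; case: (iW) => _ WD WM.
have Wtop : W top_param by apply: Wp; rewrite mem_head.
have ry : radical W 'X_x.
  exists e.+1; have -> : 'X_x ^+ e.+1 = 'X_x * top_param - 'X_x * elem e.
    by rewrite mulrDr addrK exprS.
  by apply: (idealB iW); [exact: WM | exact/LW/X_elem_top].
have re : radical W (elem e).
  have -> : elem e = top_param - 'X_x ^+ e by rewrite [top_param]addrC addrK.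
  apply: (idealB iR); first exact: sub_radical.
  rewrite -(prednK e_gt0) exprSr; case: iR => _ _ RM; exact: RM.
have [->|ix] := eqVneq i x; first exact: ry.
apply: (radical_params iW _ re _ ix) => [b bp|s _ es].
  by apply: Wp; rewrite inE bp orbT.
exact/LW/xset_big.
Qed.

(** Modulo y - 1 the relation y E_e = 0 becomes E_e = 0, so y - 1 can take the place of
    [top_param]. *)
Lemma radical_vertex (W : S -> Prop) i : ideal W ->
  (forall p, face_ideal L p -> W p) -> (forall b, b \in ('X_x - 1) :: params -> W b) ->
  i != x -> radical W 'X_i.
Proof.
move=> iW LW Wp ix; have iR := radicalP iW; case: (iW) => _ WD WM.
have re : radical W (elem e).
  apply: sub_radical; have -> : elem e = 'X_x * elem e - elem e * ('X_x - 1) by ring.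
  by apply: (idealB iW); [exact/LW/X_elem_top | apply: WM; apply: Wp; exact: mem_head].
apply: (radical_params iW _ re _ ix) => [b bp|s _ es].
  by apply: Wp; rewrite inE bp orbT.
exact/LW/xset_big.
Qed.

Lemma acyclic_origin a : regular_list (face_ideal L) a -> size a = e ->
  (forall p, p \in a -> p.@[fun=> 0 : K] = 0) ->
  acyclic (face_ideal L) (top_param :: params) 1.
Proof.
have iL := face_idealP K dL.
move=> ra sa a0; apply: (acyclic_regular_list iL ra) => [p pa|]; last first.
  by rewrite sa size_params.
have iW := ideal_addsP (top_param :: params) iL.
apply: (radical_point (pt := fun=> 0) iW _ (a0 _ pa)) => i; rewrite mpolyC0 subr0.
apply: (radical_origin i iW); [exact: sub_ideal_adds | move=> b; exact: mem_ideal_adds].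
Qed.

Lemma acyclic_vertex a : regular_list (face_ideal L) a -> size a = e ->
  (forall p, p \in a -> p.@[fun i => (i == x)%:R : K] = 0) ->
  acyclic (face_ideal L) (('X_x - 1) :: params) 1.
Proof.
have iL := face_idealP K dL.
move=> ra sa a0; apply: (acyclic_regular_list iL ra) => [p pa|]; last first.
  by rewrite sa size_params.
have iW := ideal_addsP (('X_x - 1) :: params) iL.
apply: (radical_point (pt := fun i => (i == x)%:R) iW _ (a0 _ pa)) => i.
have [->|ix] := eqVneq i x.
  by apply: sub_radical; apply: (mem_ideal_adds iL); rewrite mpolyC1 mem_head.
rewrite mpolyC0 subr0; apply: (radical_vertex iW _ _ ix).
  exact: sub_ideal_adds.
by move=> b; exact: mem_ideal_adds.
Qed.

Definition subst_x (c : S) : S -> S :=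
  mmap (@mpolyC n K) (fun i => if i == x then c else 'X_i).

HB.instance Definition _ c := GRing.RMorphism.on (subst_x c).

Lemma subst_xC c (k : K) : subst_x c k%:MP = k%:MP.
Proof. exact: mmapC. Qed.

Lemma subst_xD c : {morph subst_x c : p q / p + q}.
Proof. exact: mmapD. Qed.

Lemma subst_xM c : {morph subst_x c : p q / p * q}.
Proof. exact: rmorphM. Qed.

Lemma subst_x0 c : subst_x c 0 = 0. Proof. exact: mmap0. Qed.

Lemma subst_xU c i : subst_x c 'X_i = if i == x then c else 'X_i.
Proof. by rewrite /subst_x mmapX mmap1U. Qed.

Lemma subst_xX c m : subst_x c 'X_[m] = c ^+ m x * 'X_[m - U_(x) *+ m x].
Proof.
rewrite /subst_x mmapX /mmap1 (bigD1 x) //= eqxx mpolyXE_id; congr (_ * _).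
rewrite [RHS](bigD1 x) //= mnmBE mulmnE mnm1E eqxx mul1n subnn expr0 mul1r.
apply: eq_bigr => i ix; rewrite (negbTE ix) mnmBE mulmnE mnm1E eq_sym (negbTE ix).
by rewrite mul0n subn0.
Qed.

Local Opaque subst_x.

Lemma msupport_drop m : msupport (m - U_(x) *+ m x) = msupport m :\ x.
Proof.
apply/setP => i; rewrite !inE mnmBE mulmnE mnm1E [x == i]eq_sym.
have [->|_] := eqVneq i x; first by rewrite mul1n subnn.
by rewrite mul0n subn0.
Qed.

Lemma subst_xset c s : x \notin s -> subst_x c (xset K s) = xset K s.
Proof.
move=> xs; rewrite /xset subst_xX.
have sx : msquarefree s x = 0%N by rewrite mnmE (negbTE xs).
rewrite sx expr0 mul1r; congr mpolyX; apply/mnmP => i.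
by rewrite mnmBE mulmnE muln0 subn0.
Qed.

Lemma subst_params c p : p \in params -> subst_x c p = p.
Proof.
move=> /mapP[i _ ->]; rewrite rmorphXn /= /elem raddf_sum; congr (_ ^+ _).
by apply: eq_bigr => s /andP[_]; apply: subst_xset.
Qed.

Lemma face_ideal_subst c D (W : S -> Prop) q : ideal W ->
  (forall m, msupport m \notin D -> W (subst_x c 'X_[m])) -> face_ideal D q ->
  W (subst_x c q).
Proof.
move=> iW H Dq; rewrite [q]mpolyE big_seq.
have -> : subst_x c (\sum_(m <- msupp q | m \in msupp q) q@_m *: 'X_[m]) =
    \sum_(m <- msupp q | m \in msupp q) subst_x c (q@_m *: 'X_[m]).
  by apply: big_morph; [exact: subst_xD | exact: subst_x0].
apply: ideal_sum => // m mq; rewrite -mul_mpolyC subst_xM.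
by case: iW => _ _; apply; apply: H; exact: face_ideal_supp mq.
Qed.

Lemma subst01 p : subst_x 1 (subst_x 0 p) = subst_x 0 p.
Proof.
elim/mpolyind: p => [|c m p _ _ IH]; first by rewrite !subst_x0.
rewrite -mul_mpolyC 2!subst_xD 2!subst_xM 2!subst_xC IH.
suff -> : subst_x 1 (subst_x 0 'X_[m]) = subst_x 0 'X_[m] by [].
have subst_x0X k : subst_x 1 (0 ^+ k) = 0 ^+ k.
  by case: k => [|k]; rewrite ?expr0 -?mpolyC1 ?subst_xC // exprS mul0r subst_x0.
rewrite subst_xX subst_xM subst_x0X subst_xX.
rewrite expr1n mul1r mnmBE mulmnE mnm1E eqxx mul1n subnn.
congr (_ * _); congr mpolyX; apply/mnmP => i.
by rewrite mnmBE mulmnE muln0 subn0.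
Qed.

(* Let y be the variable of x. A cycle modulo (I_star, y) may be taken free of y,
   and y times it is then a cycle modulo I_L; putting y = 1, which carries I_L
   into I_star, turns its boundary modulo (I_L, y - 1) into one modulo I_star. *)
Lemma acyclic_link : acyclic (face_ideal L) (('X_x - 1) :: params) 1 ->
  acyclic (ideal_add (face_ideal (star L [set x])) 'X_x) params 1.
Proof.
have iL := face_idealP K dL; have dS := downward_star (s := [set x]) dL.
have iS := face_idealP K dS; move=> ac i z i0 dz Vz.
pose W : S -> Prop := ideal_add (face_ideal (star L [set x])) 'X_x.
have iW : ideal W := ideal_addP 'X_x iS.
have sub0 (p : S) : W (p - subst_x 0 p).
  elim/mpolyind: p => [|c m p _ _ IH]; first by rewrite subst_x0 subr0; case: iW.
  case: (iW) => W0 WD WM; rewrite -mul_mpolyC subst_xD subst_xM subst_xC.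
  rewrite opprD addrACA; apply: (WD) IH; rewrite -mulrBr; apply: (WM); rewrite subst_xX.
  case E: (m x) => [|k]; last first.
    rewrite expr0n mul0r subr0.
    have /(@xset_mem K)[q ->] : [set x] \subset msupport m by rewrite sub1set inE E.
    by rewrite xset1; apply: WM; apply: mem_ideal_add.
  rewrite expr0 mul1r [(_ - _)%MM](_ : _ = m) ?subrr //.
  by apply/mnmP => j; rewrite mnmBE mulmnE muln0 subn0.
have W_subst p : W p -> face_ideal (star L [set x]) (subst_x 0 p).
  case=> r Hr; rewrite -[p](subrK (r * 'X_x)) subst_xD subst_xM subst_xU eqxx mulr0 addr0.
  move: Hr; apply: (face_ideal_subst iS) => m mS; rewrite subst_xX.
  case: iS => _ _; apply; case E: (m x) => [|k].
    rewrite [(_ - _)%MM](_ : _ = m); first exact/face_idealX.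
    by apply/mnmP => j; rewrite mnmBE mulmnE muln0 subn0.
  rewrite -E; apply/face_idealX; rewrite msupport_drop.
  apply: contra mS; rewrite !inE => H; apply: dL H _; apply/subsetP => j.
  by rewrite !inE; have [->|_] := eqVneq j x; rewrite ?orbT ?orbF.
have fixp c b : b \in params -> subst_x c b = b by apply: subst_params.
set z0 := chmap (subst_x 0) z.
have dz0 : deg i z0 by apply: deg_chmap.
have Vz0 : chin (face_ideal (star L [set x])) (kd params z0).
  by rewrite -(chmap_kd _ (fixp 0)); apply: chin_chmap Vz.
have zz0 : chin W (z - z0).
  rewrite /z0; elim: (size params) (z) => [|N IH] /= u; first exact: sub0.
  by split; apply: IH.
have colon p : face_ideal (star L [set x]) p -> face_ideal L ('X_x * p).
  by move=> H; apply/face_ideal_colon; rewrite msupportU.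
have Vy : chin (face_ideal L) ('X_x *: kd params z0).
  elim: (size params) (kd params z0) Vz0 => [|N IH] /= u; first exact: colon.
  by case; split; apply: IH.
have [//|||[w1 w2] /= [dw1 _] [Vw1 _]] := ac i ('X_x *: z0, 0).
- by split; [apply: degZ | case: (i) => // k; apply: deg0].
- by split; rewrite /= ?kd0 ?oppr0 ?scaler0 ?addr0 ?kdZ //; apply: chin0.
exists (chmap (subst_x 1) w1); first exact: deg_chmap.
have L_subst p : face_ideal L p -> face_ideal (star L [set x]) (subst_x 1 p).
  apply: (face_ideal_subst iS) => m mL; rewrite subst_xX expr1n mul1r.
  apply/face_idealX; rewrite msupport_drop inE; apply: contra mL => /dL; apply.
  by apply/subsetP => j; rewrite !inE => ->; case: (j == x).
have z1 : chmap (subst_x 1) z0 = z0.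
  rewrite /z0; elim: (size params) (z) => [|N IH] /= u; first exact: subst01.
  by congr pair; apply: IH.
have := chin_chmap L_subst Vw1.
have y1 : subst_x 1 'X_x = 1 by rewrite subst_xU eqxx.
have y0 : subst_x 1 ('X_x - 1) = 0.
  by rewrite -mpolyC1 -mpolyCN subst_xD y1 subst_xC mpolyCN mpolyC1 subrr.
rewrite chmapB chmapD !chmapZ (chmap_kd _ (fixp 1)) /= y0 y1.
rewrite scale0r addr0 scale1r z1 => Vw.

rewrite -(subrK z0 z) -addrA; apply: chinD => //.
by apply: chin_mono Vw => p; apply: sub_ideal_add.
Qed.

(** A star is a cone, so y is regular modulo its ideal; y is in the radical since E_e vanishes
    there; and modulo y the top parameter is zero, which leaves [params] and [acyclic_link]. *)
Lemma acyclic_star : acyclic (face_ideal L) (('X_x - 1) :: params) 1 ->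
  acyclic (face_ideal (star L [set x])) (top_param :: params) 1.
Proof.
move=> /acyclic_link ac; have dS := downward_star (s := [set x]) dL.
have iS := face_idealP K dS; have iW := ideal_addP 'X_x iS.
apply: (@acyclic_regular _ _ _ 'X_x) => //.
- move=> p /face_ideal_colon; rewrite msupportU => H m mS; apply: H.
  by rewrite !inE -setUA setUid in mS *.
- exists e; have -> : 'X_x ^+ e = top_param - elem e by rewrite addrK.
  apply: idealB; first exact: ideal_addsP.
    by apply: mem_ideal_adds; rewrite // mem_head.
  exact/sub_ideal_adds/elem_top_star.
- apply: acyclic_cons => //; rewrite /top_param -(prednK e_gt0) exprSr prednK //.
  case: (iW) => _ WD WM; apply: WD; first by apply: WM; apply: mem_ideal_add.
  exact/sub_ideal_add/elem_top_star.
Qed.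

End Complex.

Lemma regular_list_simplex (s : seq 'I_n) (G : {set 'I_n}) : uniq s -> {subset s <= G} ->
  regular_list (face_ideal (powerset G)) [seq ('X_i : S) | i <- s].
Proof.
elim: s G => [//|i s IH] G /= /andP[i_s us] sG.
have iG : i \in G by apply: sG; rewrite mem_head.
split.
  move=> p /face_ideal_colon; rewrite msupportU => H m mG; apply: H.
  by move: mG; rewrite !inE subUset sub1set iG andbT.
have us' : {subset s <= G :\ i}.
  move=> j js; rewrite !inE sG ?inE ?js ?orbT // andbT.
  by apply: contraNneq i_s => <-.
apply: regular_list_eq (IH _ us us') => p.
have dG : downward (powerset G) by move=> t u; rewrite !inE => tG /subset_trans; apply.
rewrite -xset1 (face_ideal_add _ _ dG) [deletion _ _](_ : _ = powerset (G :\ i)) //.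
by apply/setP => t; rewrite !inE sub1set subsetD1.
Qed.

Lemma acyclic_simplex (F : {set 'I_n}) : #|F| = e -> x \notin F ->
  acyclic (face_ideal (powerset F)) (top_param :: params) 1.
Proof.
move=> Fe xF; have dF : downward (powerset F).
  by move=> t u; rewrite !inE => tG /subset_trans; apply.
have iF := face_idealP K dF.
have rl : regular_list (face_ideal (powerset F)) [seq ('X_i : S) | i <- enum F].
  by apply: regular_list_simplex (enum_uniq _) _ => i; rewrite mem_enum.
apply: (acyclic_regular_list iF rl) => [p /mapP[i]|]; last first.
  by rewrite size_params size_map -cardE Fe.
rewrite mem_enum => iF' ->; set W := ideal_adds _ _.
have iW : ideal W by apply: ideal_addsP.
have Vx : face_ideal (powerset F) ('X_x : S).
  by apply/face_idealX; rewrite msupportU inE sub1set.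
have ix : i != x by apply: contraNneq xF => <-.
apply: radical_params ix => // [b bp||s xs es].
- by apply: mem_ideal_adds; rewrite // inE bp orbT.
- apply: sub_radical; have -> : elem e = top_param - 'X_x ^+ e by rewrite [top_param]addrC addrK.
  apply: idealB => //; first by apply: mem_ideal_adds; rewrite // mem_head.
  rewrite -(prednK e_gt0) exprSr; case: (iW) => _ _; apply.
  exact: sub_ideal_adds.
- apply/sub_ideal_adds/face_ideal_xset; rewrite inE; apply/negP => /subset_leq_card.
  by rewrite Fe leqNgt es.
Qed.

Definition trim (L : {set {set 'I_n}}) : {set {set 'I_n}} :=
  [set t in L | (x \notin t) && (#|t| < e)%N].

Lemma acyclic_trim L a0 : downward L -> (forall s, s \in L -> (#|s| <= e)%N) ->
  regular_list (face_ideal L) a0 -> size a0 = e ->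
  (forall p, p \in a0 -> p.@[fun=> 0 : K] = 0) ->
  ([set x] \in L -> exists a1, [/\ regular_list (face_ideal L) a1, size a1 = e &
    forall p, p \in a1 -> p.@[fun i => (i == x)%:R : K] = 0]) ->
  acyclic (face_ideal (trim L)) params 1.
Proof.
move=> dL Le ra sa a00 H1.
have ac0 := acyclic_origin dL Le ra sa a00.
have acx : acyclic (face_ideal (deletion L [set x])) (top_param :: params) 2.
  apply: acyclic_eq (fun p => face_ideal_add [set x] p dL) _.
  apply: acyclic_add; [exact: face_idealP | exact: acyclicW ac0 |].
  case: (boolP ([set x] \in L)) => [/H1[a1 [r1 s1 a10]]|xL].
    have := acyclic_star dL Le (acyclic_vertex dL Le r1 s1 a10).
    apply: acyclic_eq => p; rewrite xset1.
    by have := face_ideal_colon L U_(x) p; rewrite msupportU => H; split=> /H.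
  (* Here x is no vertex: the star is empty and its ideal is the whole ring. *)
  apply: acyclic_top => p; rewrite xset1; apply/face_ideal_colon => m.
  rewrite msupportU inE => /dL H; case/negP: xL; apply: H; exact: subsetUr.
(* The list may contain sets that are not faces; they change nothing, so that all sets of size e can
   be enumerated at the end. *)
have facets (s : seq {set 'I_n}) : (forall F, F \in s -> #|F| = e) ->
    acyclic (face_ideal [set t in deletion L [set x] | t \notin s]) (top_param :: params) 2.
  elim: s => [|F s IH] Hs.
    apply: acyclic_eq acx => p; rewrite [X in _ <-> face_ideal X p](_ : _ = deletion L [set x]) //.
    by apply/setP => t; rewrite !inE andbT.
  have {}IH := IH (fun G Gs => Hs G (@mem_behead _ (F :: s) G Gs)).
  set D := [set t in deletion L [set x] | t \notin s] in IH.
  have FE : #|F| = e by apply: Hs; rewrite mem_head.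
  have dD : downward D.
    move=> t u; rewrite !inE !sub1set => /andP[/andP[tL xt] ts] ut.
    rewrite (dL _ _ tL ut) (contra (subsetP ut x) xt) /=.
    apply: contra ts => us; have ue : #|u| = e by apply: Hs; rewrite inE us orbT.
    by rewrite (_ : t = u) //; apply/eqP; rewrite eq_sym eqEcard ut ue Le.
  have maxF t : t \in D -> F \subset t -> t = F.
    rewrite !inE => /andP[/andP[tL _] _] Ft; apply/eqP; rewrite eq_sym eqEcard Ft FE; exact: Le.
  case: (boolP (F \in D)) => FD; last first.
    apply: acyclic_eq IH => p; rewrite [X in _ <-> face_ideal X p](_ : _ = D) //.
    apply/setP => t; move: FD; rewrite !inE negb_or; case: eqP => [->|//].
    by move/negbTE => ->; rewrite andbF.
  have delF : deletion D F = [set t in deletion L [set x] | t \notin F :: s].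
    apply/setP => t; have : t \in D -> (F \subset t) = (t == F).
      by move=> tD; apply/idP/eqP => [/(maxF _ tD)|->].
    rewrite !inE negb_or; case: (t \in L) => //=; case: ([set x] \subset t) => //=.
    by case: (t \in s) => /= H; [rewrite andbF | rewrite H ?andbT].
  rewrite -delF; apply: acyclic_eq (fun p => face_ideal_add F p dD) _.
  apply: acyclic_add; [exact: face_idealP | exact: IH |].
  have xF : x \notin F by move: FD; rewrite !inE sub1set => /andP[/andP[]].
  have := acyclic_simplex FE xF; apply: acyclic_eq => p.
  (* A face with e elements is maximal, so its star is the full simplex on it. *)
  have -> : powerset F = star D (msupport (msquarefree F)).
    rewrite msupport_squarefree; apply/setP => t; rewrite !inE.
    apply/idP/idP => [tF|]; first by move: FD; rewrite (setUidPr tF) !inE.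
    move=> H; have /maxF <- : t :|: F \in D by rewrite !inE.
      exact: subsetUl.
    exact: subsetUr.
  by split=> /face_ideal_colon.
have dT : downward (trim L).
  move=> t u; rewrite !inE => /and3P[tL xt te] ut.
  rewrite (dL _ _ tL ut) (contra (subsetP ut x) xt) /=.
  exact: leq_ltn_trans (subset_leq_card ut) te.
apply: (@acyclic_drop _ _ _ top_param).
- exact: face_idealP.
- have [_ TD TM] := face_idealP K dT; apply: TD.
    rewrite -(prednK e_gt0) exprSr; apply: TM; apply/face_idealX.
    by rewrite msupportU !inE eqxx andbF.
  by apply: elem_top_notin => s sE _; rewrite !inE sE ltnn !andbF.
- have := facets (enum [set F : {set 'I_n} | #|F| == e]) _.
  rewrite [X in face_ideal X](_ : _ = trim L); first apply.
    by move=> F; rewrite mem_enum inE => /eqP.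
  apply/setP => t; rewrite !inE mem_enum inE sub1set -andbA.
  by case: (boolP (t \in L)) => //= /Le; rewrite ltn_neqAle => ->; rewrite andbT.
Qed.

End Point.
End SystemOfParams.

(** * Regular sequences and chains of primes *)

Section RegularSequences.
Variable R : comNzRingType.
Implicit Types (V W : R -> Prop) (s l : seq R).

Lemma in_span_cons b s x : in_span (b :: s) x <-> exists r, in_span s (x - r * b).
Proof.
split=> [[c ->]|[r [c xE]]].
  exists (c 0%N), (fun i => c i.+1).
  by rewrite big_ord_recl /= addrAC subrr add0r.
exists (fun i => if i is i'.+1 then c i' else r).
by rewrite big_ord_recl /= -xE addrC subrK.
Qed.

Lemma in_span_nil x : in_span [::] x <-> x = 0 :> R.
Proof. by split=> [[c ->]|->]; [rewrite big_ord0 | exists (fun=> 0); rewrite big_ord0]. Qed.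

Lemma in_span_ideal_adds s x : in_span s x <-> ideal_adds (fun y => y = 0) s x.
Proof.
elim: s x => [|b s IH] x; first exact: in_span_nil.
by rewrite in_span_cons; split=> -[r /IH]; exists r.
Qed.

Lemma ideal0 : ideal (fun y : R => y = 0).
Proof. by split=> [|p q -> ->|r p ->]; rewrite ?addr0 ?mulr0. Qed.

Lemma ideal_span s : ideal (in_span s).
Proof.
have [H0 HD HM] := ideal_addsP s ideal0; split=> [|p q|r p]; rewrite !in_span_ideal_adds //.
  exact: HD.
exact: HM.
Qed.

Lemma mem_in_span s a : a \in s -> in_span s a.
Proof. by move=> ?; apply/in_span_ideal_adds/mem_ideal_adds => //; exact: ideal0. Qed.

Lemma in_span_min W s p : ideal W -> (forall a, a \in s -> W a) -> in_span s p -> W p.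
Proof.
move=> iW sW /in_span_ideal_adds; apply: ideal_adds_min => // q ->.
by case: iW.
Qed.

Lemma ideal_adds_perm V l s p : ideal V -> l =i s -> ideal_adds V l p -> ideal_adds V s p.
Proof.
move=> iV ls; apply: ideal_adds_min; [exact: ideal_addsP | exact: sub_ideal_adds|].
by move=> a; rewrite ls; apply: mem_ideal_adds.
Qed.

Lemma regular_listP V (pre a : seq R) : ideal V ->
  (forall i, (i < size a)%N -> regular_mod (ideal_adds V (pre ++ take i a)) a`_i) <->
  regular_list (ideal_adds V pre) a.
Proof.
move=> iV; elim: a pre => [|b a IH] pre; first by split.
have key W W' c : (forall p, W p <-> W' p) -> regular_mod W c -> regular_mod W' c.
  by move=> WW H p /WW/H/WW.
have E p : ideal_adds V (b :: pre) p <-> ideal_adds V (rcons pre b) p.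
  by split; apply: ideal_adds_perm => // q; rewrite mem_rcons.
split=> [H|[/= rb ra] [_|i /= ia]].
- split; first by have := H 0%N isT; rewrite /= cats0.
  apply: (@regular_list_eq _ (ideal_adds V (rcons pre b))) => [p|].
    by split=> /E.
  by apply/IH => i ia; have := H i.+1 ia; rewrite /= cat_rcons.
- by rewrite /= cats0.
- rewrite -cat_rcons; apply: (IH (rcons pre b)).2 ia.
  by apply: regular_list_eq ra => p; split=> /E.
Qed.

End RegularSequences.

Section Transfer.
Variables (S Q : comNzRingType) (pi : {rmorphism S -> Q}).
Hypothesis pi_surj : forall q, exists p, pi p = q.

Lemma kernel_ideal : ideal (fun p => pi p = 0).
Proof.
split=> [|p q p0 q0|r p p0]; first exact: rmorph0.
  by rewrite rmorphD p0 q0 addr0.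
by rewrite rmorphM p0 mulr0.
Qed.

Lemma in_span_map a p :
  in_span (map pi a) (pi p) <-> ideal_adds (fun p => pi p = 0) a p.
Proof.
elim: a p => [|b a IH] p /=; first exact: in_span_nil.
rewrite in_span_cons; split=> [[r]|[r /IH H]].
  by have [r' <-] := pi_surj r; rewrite -rmorphM -rmorphB => /IH; exists r'.
by exists (pi r); rewrite -rmorphM -rmorphB.
Qed.

Lemma regular_map a :
  (forall i, (i < size a)%N -> forall x, in_span (take i (map pi a)) ((map pi a)`_i * x) ->
     in_span (take i (map pi a)) x) <-> regular_list (fun p => pi p = 0) a.
Proof.
rewrite -(@regular_listP _ _ [::] a kernel_ideal) /=.
split=> H i ia p.
  have := H i ia (pi p); rewrite -map_take (nth_map 0) // -rmorphM.
  by move=> {}H /in_span_map/H/in_span_map.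
have [q <-] := pi_surj p; rewrite -map_take (nth_map 0) // -rmorphM.
by move=> /in_span_map/(H i ia)/in_span_map.
Qed.

End Transfer.

Section PrimeChains.
Variable R : comNzRingType.
Implicit Types (P : {pred R}) (s : seq R).

Lemma idealr_closedP P : idealr_closed P -> ideal (fun x => x \in P).
Proof.
case=> P0 _ PD; split=> // [p q pP qP|r p pP].
  by have := PD 1 p q pP qP; rewrite mul1r.
by have := PD r p 0 pP P0; rewrite addr0.
Qed.

Lemma ideal_idealr_closed (V : R -> Prop) (P : {pred R}) :
  (forall x, x \in P <-> V x) -> ideal V -> ~ V 1 -> idealr_closed P.
Proof.
move=> PV [V0 VD VM] V1; split; [exact/PV | exact/negP/PV |].
by move=> a u v /PV Vu /PV Vv; apply/PV/VD => //; apply: VM.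
Qed.

(* Zorn on the ideals containing I and avoiding the powers of a times the
   complement of P. *)
Lemma prime_avoiding (I : R -> Prop) P a : ideal I -> prime_ideal P ->
  (forall x, I x -> x \in P) -> regular_mod I a ->
  exists P', [/\ prime_ideal P', forall x, I x -> x \in P',
    {subset P' <= P} & a \notin P'].
Proof.
move=> iI [idP primeP] IP rega; have iP := idealr_closedP idP.
have P1 : 1 \notin P by case: idP.
pose M x := exists k u, u \notin P /\ x = a ^+ k * u.
pose good (A : R -> Prop) := [/\ ideal A, forall x, I x -> A x & forall x, A x -> ~ M x].
have goodI : good I.
  split=> // x Ix [k [u [/negP uP xE]]]; apply: uP; apply: IP; move: Ix; rewrite {}xE.
  elim: k => [|k IH]; first by rewrite expr0 mul1r.
  by rewrite exprS -mulrA => /rega.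
(* The second alternative admits the union of the empty chain. *)
pose Pz := fun A : classical_sets.set R => good A \/ forall x, ~ A x.
have [F FP Ftot|A [PA Amax]] := @classical_sets.Zorn_bigcup R Pz.
  have [[A [FA [x Ax]]]|none] := boolp.EM (exists A, F A /\ exists x, A x); last first.
    by right=> x [A FA Ax]; apply: none; exists A; split => //; exists x.
  left; have goodF B y : F B -> B y -> good B.
    by move=> FB By; case: (FP B FB) => // /(_ y).
  have gA := goodF A x FA Ax; split.
  - split.
    + by exists A => //; case: gA => -[].
    + move=> p q [B FB Bp] [C FC Cq].
      have [BC|CB] := Ftot B C FB FC.
        exists C => //; have [[_ CD _] _ _] := goodF C q FC Cq; apply: CD => //.
        exact: BC.
      exists B => //; have [[_ BD _] _ _] := goodF B p FB Bp; apply: BD => //.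
      exact: CB.
    + move=> r p [B FB Bp]; exists B => //.
      by have [[_ _ BM] _ _] := goodF B p FB Bp; apply: BM.
  - by move=> y Iy; exists A => //; case: gA => _ IA _; apply: IA.
  - by move=> y [B FB By]; have [_ _] := goodF B y FB By; apply.
have gA : good A.
  case: PA => // Aempty; case: (Amax I); last by left.
  split=> [x /Aempty//|IA]; apply: (Aempty 0); apply: IA.
  by case: iI.
have [iA IA AM] := gA; have [A0 AD AMu] := iA.
have ext u : ~ A u -> exists2 x, ideal_add A u x & M x.
  move=> Au; apply: boolp.contrapT => none; apply: (Amax (ideal_add A u)).
    split=> [x|/(_ u (mem_ideal_add u iA))//]; exact: sub_ideal_add.
  left; split; [exact: ideal_addP | by move=> x /IA; apply: sub_ideal_add |].
  by move=> x Ax Mx; apply: none; exists x.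
pose P' : {pred R} := fun x => boolp.asbool (A x).
have P'E x : x \in P' <-> A x by split=> [/boolp.asboolP|?]; last exact/boolp.asboolP.
have M1 u : u \notin P -> M u by exists 0%N, u; rewrite expr0 mul1r.
exists P'; split.
- split; first by apply: ideal_idealr_closed P'E iA _ => /AM; apply; apply: M1.
  move=> u v /P'E Auv; apply/negPn/negP; rewrite negb_or => /andP[/negP nu /negP nv].
  have [|x [r Ar] [k [w [wP xE]]]] := ext u; first by move=> /P'E.
  have [|y [t At] [l [w' [wP' yE]]]] := ext v; first by move=> /P'E.
  apply: (AM (x * y)).
    have -> : x * y = y * (x - r * u) + r * u * (y - t * v) + r * t * (u * v) by ring.
    by apply: (AD); [apply: (AD) |]; apply: AMu.
  exists (k + l)%N, (w * w'); split; last by rewrite xE yE exprD; ring.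
  by apply/negP => /primeP; rewrite (negbTE wP) (negbTE wP').
- by move=> x /IA/P'E.
- move=> x /P'E Ax; apply: boolp.contrapT => /negP xP; apply: (AM x) => //; exact: M1.
- apply/negP => /P'E /AM; apply; exists 1%N, 1; by rewrite expr1 mulr1.
Qed.

(** The last element a is regular modulo the others, so below P there is a prime containing these
    but not a; the induction continues from that prime. *)
Lemma regular_prime_chain P s : prime_ideal P ->
  (forall i, (i < size s)%N -> forall x, in_span (take i s) (s`_i * x) -> in_span (take i s) x) ->
  {subset s <= P} -> exists c, prime_chain_to P (size s) c.
Proof.
elim/last_ind: s P => [|s a IH] P pP reg sP.
  by exists (fun=> P); split.
have iP := idealr_closedP pP.1.
have [||P' [pP' sP' P'P aP']] := @prime_avoiding (in_span s) P a (ideal_span s) pP.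
- move=> x; apply: in_span_min iP _ => b bs; apply: sP.
  by rewrite mem_rcons inE bs orbT.
- move=> x; have := reg (size s); rewrite size_rcons ltnSn => /(_ isT x).
  by rewrite -cats1 take_size_cat // nth_cat ltnn subnn.
have [i si|x xs|c [cp cs cP']] := IH P' pP'.
- move=> x; have := reg i; rewrite size_rcons ltnS (ltnW si) => /(_ isT x).
  by rewrite -cats1 takel_cat ?(ltnW si) // nth_cat si.
- exact/sP'/mem_in_span.
exists (fun i => if (i <= size s)%N then c i else P); rewrite size_rcons; split.
- by move=> i _; case: ifP => // /cp.
- move=> i i_s; have /orP[/eqP->|si] : (i == size s) || (i < size s)%N by rewrite -leq_eqVlt.
    rewrite leqnn ltnn; split=> [x|PP']; first by rewrite cP'; apply: P'P.
    by case/negP: aP'; rewrite -cP'; apply: PP'; apply: sP; rewrite mem_rcons mem_head.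
  by rewrite si (ltnW si); apply: cs.
- by move=> x; rewrite ltnn.
Qed.

End PrimeChains.

(** * Zariski's lemma *)

Lemma size_1XG (E : idomainType) (G : {poly E}) : G != 0 ->
  size (1 + 'X * G) = (size G).+1.
Proof.
by move=> G0; rewrite addrC size_polyDl mulrC size_mulX // size_poly1 ltnS size_poly_gt0.
Qed.

(** 1 + X G is prime to G and not constant, so it divides no power of G. This takes the place of the
    infinitude of irreducible polynomials. *)
Lemma coprime_1XG (E : idomainType) (G C : {poly E}) N : G != 0 ->
  (1 + 'X * G) * C = G ^+ N -> False.
Proof.
move=> G0 H; pose Y : {poly E} := - ('X * G).
have [W HW] : exists W, 1 - Y ^+ N = (1 - Y) * W.
  by rewrite -{1}(expr1n _ N) subrXX; eexists; reflexivity.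
have : (1 + 'X * G) * (W + (- 'X) ^+ N * C) = 1.
  have -> : 1 + 'X * G = 1 - Y by rewrite opprK.
  rewrite mulrDr -HW [_ * (_ * C)]mulrCA opprK H -exprMn_comm; last exact: mulrC.
  by rewrite mulNr -/Y subrK.
move/(congr1 (fun p : {poly E} => size p)); rewrite size_poly1.
have nz : 1 + 'X * G != 0 by rewrite -size_poly_eq0 size_1XG.
set Z := W + _; have [->|Z0] := eqVneq Z 0; first by rewrite mulr0 size_poly0.
rewrite size_mul // size_1XG //; move: G0 Z0; rewrite -!size_poly_gt0.
by case: (size G) (size Z) => [|a] [|b] //=; rewrite addnS.
Qed.

Section Zariski.
Variables (R : comNzRingType) (E : idomainType) (iota : {rmorphism R -> E}).

Lemma horner_map_wide n (p : {poly R}) x : (size p <= n)%N ->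
  (map_poly iota p).[x] = \sum_(i < n) iota p`_i * x ^+ i.
Proof.
move=> pn; rewrite (@horner_coef_wide _ n).
  by apply: eq_bigr => i _; rewrite coef_map.
exact: leq_trans (size_poly _ _) pn.
Qed.

Lemma integral_lead (q : {poly R}) u k : size q = k.+2 ->
  (map_poly iota q).[u] = 0 -> integralOver iota (iota (lead_coef q) * u).
Proof.
move=> qk qu; set c := lead_coef q.
pose p := \poly_(i < k.+2) (if i == k.+1 then 1 else q`_i * c ^+ (k - i)).
have sp : size p = k.+2 by apply: size_poly_eq; rewrite eqxx oner_neq0.
exists p; first by apply/monicP; rewrite lead_coefE sp coef_poly ltnSn eqxx.
apply/rootP; rewrite (@horner_map_wide k.+2) ?sp //.
transitivity (iota c ^+ k * (map_poly iota q).[u]); last by rewrite qu mulr0.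
rewrite (@horner_map_wide k.+2) ?qk // mulr_sumr; apply: eq_bigr => i _.
rewrite coef_poly ltn_ord exprMn; case: (eqVneq (i : nat) k.+1) => [->|ik].
  by rewrite /c lead_coefE qk rmorph1 mul1r exprSr mulrA.
have ik' : (i <= k)%N by have := ltn_ord i; lia.
have -> : iota c ^+ k = iota c ^+ (k - i) * iota c ^+ i by rewrite -exprD subnK.
rewrite rmorphM rmorphXn; ring.
Qed.

Lemma integral_denominator u c (p : {poly R}) M : integralOver iota (iota c * u) ->
  (size p <= M)%N -> integralOver iota (iota c ^+ M * (map_poly iota p).[u]).
Proof.
move=> icu pM; rewrite (horner_map_wide _ pM) mulr_sumr.
elim/big_ind: _ => [|x y|i _]; [exact: integral0 | exact: integral_add |].
have -> : iota c ^+ M = iota c ^+ (M - i) * iota c ^+ i.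
  by rewrite -exprD subnK // ltnW.
rewrite [_ * _](_ : _ = iota (c ^+ (M - i) * p`_i) * (iota c * u) ^+ i); last first.
  by rewrite rmorphM rmorphXn exprMn; ring.
apply: integral_mul; first exact: integral_id.
elim: (i : nat) => [|j IH]; first exact: integral1.
by rewrite exprS; apply: integral_mul.
Qed.

(** In an integral equation for w, the power of w at the lowest coefficient with nonzero image can
    be cancelled; that coefficient is then a multiple of w. *)
Lemma integral_multiple_id w : integralOver iota w -> w != 0 ->
  exists b t, iota b != 0 /\ iota b = w * (map_poly iota t).[w].
Proof.
case=> p mp /rootP pw w0.
have : exists j, iota p`_j != 0.
  by exists (size p).-1; rewrite -lead_coefE (monicP mp) rmorph1 oner_neq0.
move=> ex; case: (ex_minnP ex) => j pj jmin.
pose t : {poly R} := - drop_poly j.+1 p.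
exists p`_j, t; split=> //.
have pE : p = take_poly j p + (p`_j)%:P * 'X^j + drop_poly j.+1 p * 'X^(j.+1).
  rewrite -{1}(poly_take_drop j.+1 p); congr (_ + _).
  apply/polyP => i; rewrite coefD !coef_take_poly coefCM coefXn.
  rewrite ltnS leq_eqVlt; have [->|ij] := eqVneq i j; first by rewrite ltnn mulr1 add0r.
  by rewrite mulr0 addr0.
have : (map_poly iota p).[w] = w ^+ j * (iota p`_j - w * (map_poly iota t).[w]).
  rewrite {1}pE !rmorphD !rmorphM /= !hornerE !map_polyXn map_polyC !hornerE.
  have -> : map_poly iota (take_poly j p) = 0.
    apply/polyP => i; rewrite coef_map coef_take_poly coef0; case: ltnP => ij; last exact: rmorph0.
    by apply/eqP; apply: contraTT ij => /jmin; rewrite leqNgt.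
  by rewrite rmorphN hornerN exprS horner0; ring.
rewrite pw => /esym/eqP; rewrite mulf_eq0 expf_eq0 (negbTE w0) andbF /= subr_eq0.
by move/eqP.
Qed.

(** Multiply an integral equation of degree l for w by h^l and replace h w by d: all terms but d^l
    carry a factor h. *)
Lemma integral_quotient h d w : iota h * w = iota d -> integralOver iota w ->
  exists r l, iota h * iota r = iota d ^+ l.
Proof.
move=> hw [p mp /rootP pw]; have [l sp] : exists l, size p = l.+1.
  by exists (size p).-1; rewrite prednK // size_poly_gt0 monic_neq0.
have := horner_map_wide w (leqnn (size p)); rewrite pw sp big_ord_recr /=.
have -> : p`_l = 1 by have := monicP mp; rewrite lead_coefE sp.
rewrite rmorph1 mul1r => /esym/eqP; rewrite addrC addr_eq0 => /eqP wl.
case: l sp wl => [|l] sp wl.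
  move: wl; rewrite big_ord0 expr0 oppr0 => /eqP; by rewrite oner_eq0.
exists (- \sum_(i < l.+1) p`_i * h ^+ (l - i) * d ^+ i), l.+1.
have E1 : iota h ^+ l * w ^+ l.+1 = w * iota d ^+ l by rewrite -hw exprMn exprS; ring.
rewrite -hw exprMn wl exprS -mulrA; congr (_ * _).
rewrite rmorphN rmorph_sum mulrN mulr_sumr; congr (- _); apply: eq_bigr => i _.
have il : (i <= l)%N by rewrite -ltnS.
have -> : iota h ^+ l = iota h ^+ (l - i) * iota h ^+ i by rewrite -exprD subnK.
rewrite !rmorphM !rmorphXn -hw exprMn; ring.
Qed.

End Zariski.

Definition generates (R : comNzRingType) (E : idomainType) (iota : {rmorphism R -> E})
    (xs : seq E) :=
  forall A : E -> Prop, (forall r, A (iota r)) -> (forall x, x \in xs -> A x) ->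
    (forall x y, A x -> A y -> A (x + y)) -> (forall x y, A x -> A y -> A (x * y)) ->
  forall y, A y.

(** The image of R becomes a field once g is inverted. The base is an arbitrary ring so that the
    induction can pass to R[X], and [iota] need not be injective, hence nonvanishing is always
    tested in E. *)
Lemma zariski (E : idomainType) (Einv : forall x : E, x != 0 -> exists y, x * y = 1)
    xs (R : comNzRingType) (iota : {rmorphism R -> E}) : generates iota xs ->
  exists2 g, iota g != 0 & forall h, iota h != 0 ->
    exists c N, iota h * iota c = iota g ^+ N.
Proof.
elim: xs R iota => [|u xs IH] R iota gen.
  exists 1; rewrite ?rmorph1 ?oner_neq0 // => h h0.
  have [y hy] := Einv _ h0; have [c cE] : exists c, iota c = y.
    apply: (gen (fun y => exists c, iota c = y)) => // [r|x z|x z].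
    - by exists r.
    - by move=> [r <-] [t <-]; exists (r + t); rewrite rmorphD.
    - by move=> [r <-] [t <-]; exists (r * t); rewrite rmorphM.
  by exists c, 0%N; rewrite cE hy expr0.
have cu : commr_rmorph iota u by move=> r; apply: mulrC.
pose iota1 : {rmorphism {poly R} -> E} := horner_morph cu.
have iota1E p : iota1 p = (map_poly iota p).[u] by [].
have [A A1 A2 A3 A4|g1 g10 g1P] := IH {poly R} iota1.
  apply: gen => // [r|x].
    by have := A1 r%:P; rewrite iota1E map_polyC hornerC.
  rewrite inE => /orP[/eqP->|]; last exact: A2.
  by have := A1 'X; rewrite iota1E map_polyX hornerX.
(* If u is transcendental over the image of R, the induction hypothesis for R[X] is contradicted by
   1 + X g1. *)
have [[q [q0 qu]]|noalg] := boolp.EM (exists q, map_poly iota q != 0 /\ iota1 q = 0); last first.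
  have inj p : iota1 p = 0 -> map_poly iota p = 0.
    by move=> p0; apply/eqP/negPn/negP => np; apply: noalg; exists p.
  have G0 : map_poly iota g1 != 0.
    by apply: contraNneq g10; rewrite iota1E => ->; rewrite horner0.
  have hE : map_poly iota (1 + 'X * g1) = 1 + 'X * map_poly iota g1.
    by rewrite rmorphD rmorphM rmorph1 /= map_polyX.
  have [/inj|/g1P[c [N cN]]] := eqVneq (iota1 (1 + 'X * g1)) 0.
    by rewrite hE => /(congr1 (fun p : {poly E} => size p)); rewrite size_1XG ?size_poly0.
  case: (@coprime_1XG _ _ (map_poly iota c) N G0); apply/eqP; rewrite -subr_eq0.
  rewrite -hE -rmorphM -rmorphXn -rmorphB; apply/eqP/inj.
  by rewrite rmorphB rmorphM rmorphXn cN subrr.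
have mq0 : (0 < size (map_poly iota q))%N by rewrite size_poly_gt0.
(* Top coefficients killed by [iota] are cut off, so that the leading coefficient has nonzero
   image. *)
pose q' := take_poly (size (map_poly iota q)) q.
have mq' : map_poly iota q' = map_poly iota q.
  apply/polyP => i; rewrite coef_map coef_take_poly; case: ltnP => iq; first by rewrite coef_map.
  by rewrite /= rmorph0 nth_default.
have lq' : iota q'`_(size (map_poly iota q)).-1 != 0.
  by rewrite coef_take_poly prednK // leqnn -coef_map -lead_coefE lead_coef_eq0.
have sq' : size q' = size (map_poly iota q).
  apply/eqP; rewrite eqn_leq size_take_poly /= -(prednK mq0) ltnNge.
  by apply: contra lq' => /leq_sizeP/(_ _ (leqnn _))->; rewrite rmorph0.
have [k qk] : exists k, size q' = k.+2.
  case: (size (map_poly iota q)) {lq'} sq' mq0 (size1_polyC (p := map_poly iota q)) => [|[|k]] //.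
    move=> _ _ /(_ (leqnn _)) qE; move: qu q0; rewrite iota1E qE hornerC polyC_eq0.
    by move=> ->; rewrite eqxx.
  by move=> -> _ _; exists k.
set c0 := lead_coef q'.
have c00 : iota c0 != 0 by rewrite /c0 lead_coefE sq'.
have icu : integralOver iota (iota c0 * u).
  by apply: integral_lead qk _; rewrite mq' -iota1E.
have [|beta [t [beta0 betaE]]] := integral_multiple_id (integral_denominator icu (leqnn (size g1))).
  by rewrite mulf_neq0 ?expf_neq0.
pose s := c0%:P ^+ size g1 * g1.
have iC r : iota1 r%:P = iota r by rewrite iota1E map_polyC hornerC.
have sE : iota1 s = iota c0 ^+ size g1 * (map_poly iota g1).[u].
  by rewrite rmorphM rmorphXn iC iota1E.
have [tau tauE] : exists tau, iota beta = iota1 g1 * iota1 tau.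
  exists (c0%:P ^+ size g1 * \sum_(i < size t) (t`_i)%:P * s ^+ i).
  rewrite betaE -sE (horner_map_wide _ _ (leqnn (size t))) sE rmorphM rmorphXn iC mulrCA mulrA.
  congr (_ * _); rewrite rmorph_sum; apply: eq_bigr => i _.
  by rewrite rmorphM rmorphXn iC sE.
(* Inverting c0 makes u integral, and beta is a multiple of g1 that lies in the base R, unlike g1
   itself. *)
exists (c0 * beta); first by rewrite rmorphM mulf_neq0.
move=> h h0; have [|c [N cN]] := g1P h%:P; first by rewrite iC.
pose z := c * tau ^+ N.
have hz : iota h * iota1 z = iota beta ^+ N.
  by rewrite rmorphM rmorphXn mulrA -iC cN -exprMn -tauE.
have [|r [l rl]] := @integral_quotient _ _ iota h (c0 ^+ size z * beta ^+ N) _ _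
    (integral_denominator icu (leqnn (size z))).
  by rewrite mulrCA -iota1E hz rmorphM !rmorphXn.
exists (r * (c0 ^+ N * beta ^+ size z) ^+ l), ((size z + N) * l)%N.
rewrite rmorphM mulrA rl !rmorphXn !rmorphM !rmorphXn exprM -exprMn; congr (_ ^+ l).
by rewrite exprMn !exprD; ring.
Qed.

(** * Residue fields and the Nullstellensatz *)

Lemma maximal_ideal_ext (Q : comNzRingType) (m : {pred Q}) x : maximal_ideal m ->
  x \notin m -> exists2 a, a \in m & exists r, 1 = a + r * x.
Proof.
move=> [idm maxm] xm; have im := idealr_closedP idm.
have iJ' := ideal_addP x im.
apply: boolp.contrapT => none.
pose J : {pred Q} := fun y => boolp.asbool (ideal_add (fun z => z \in m) x y).
have JE y : y \in J <-> ideal_add (fun z => z \in m) x y.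
  by split=> [/boolp.asboolP|?]; last exact/boolp.asboolP.
case/negP: xm; apply: (maxm J) => [|y ym|].
- apply: ideal_idealr_closed JE iJ' _ => -[r rm]; apply: none.
  by exists (1 - r * x) => //; exists r; rewrite subrK.
- by apply/JE/sub_ideal_add.
- by apply/JE/mem_ideal_add.
Qed.

Lemma maximal_prime (Q : comNzRingType) (m : {pred Q}) : maximal_ideal m -> prime_ideal m.
Proof.
move=> mm; split; first exact: mm.1.
have [_ mD mM] := idealr_closedP mm.1.
move=> u v uv; apply/negPn/negP; rewrite negb_or => /andP[um vm].
have [a am [r E]] := maximal_ideal_ext mm um.
case/negP: vm; have -> : v = v * a + r * (u * v) by rewrite -[v in LHS]mulr1 E; ring.
by apply: mD; apply: mM.
Qed.

Lemma residue_field (Q : comNzRingType) (m : {pred Q}) : maximal_ideal m ->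
  exists (E : fieldType) (rho : {rmorphism Q -> E}),
    (forall y, exists q, rho q = y) /\ (forall q, rho q = 0 <-> q \in m).
Proof.
move=> mm; pose mI : idealr Q := HB.pack m (isIdealr.Build Q m mm.1).
pose E := {ideal_quot mI}; pose rho : {rmorphism Q -> E} := \pi_E%qT.
have rho0 q : rho q = 0 <-> q \in m.
  have -> : (q \in m) = (rho q == rho 0).
    by rewrite -[q in LHS]subr0; exact: (@Quotient.idealrBE Q mI q 0).
  by rewrite rmorph0; split=> /eqP.
have surj (y : E) : exists q, rho q = y by exists (repr y); apply: reprK.
have inv (x : E) : exists y : E, (x != 0 -> y * x = 1) /\ (x = 0 -> y = 0).
  have [q <-] := surj x; have [q0|q0] := eqVneq (rho q) 0.
    by exists 0; split => //; rewrite q0.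
  have [|a am [r e]] := @maximal_ideal_ext Q m q mm.
    by apply: contra q0 => /rho0/eqP.
  exists (rho r); split=> [_|e0]; last by rewrite e0 eqxx in q0.
  by rewrite -rmorphM -(rmorph1 rho) e rmorphD (rho0 a).2 // add0r.
have [f fP] := boolp.choice inv.
pose F : fieldType := HB.pack E
  (GRing.ComNzRing_isField.Build E (fun x => (fP x).1) ((fP 0).2 erefl)).
by exists F, rho.
Qed.

Section Nullstellensatz.
Variables (K : fieldType) (n : nat) (Q : comNzRingType) (pi : {rmorphism {mpoly K[n]} -> Q}).
Hypothesis pi_surj : forall q, exists p, pi p = q.

(** Otherwise K[X], with X sent to the class of p, embeds in the residue field, and 1 + X g would
    divide a power of the g given by [zariski]. As K need not be algebraically closed, polynomials
    of any degree occur. *)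
Lemma maximal_algebraic (m : {pred Q}) p : maximal_ideal m ->
  exists2 g : {poly K}, g \is monic & pi (map_poly (@mpolyC n K) g).[p] \in m.
Proof.
move=> /residue_field[E [rho0 [rho_surj rhoP]]].
pose rho : {rmorphism {mpoly K[n]} -> E} := rho0 \o pi.
have cp : commr_rmorph (rho \o @mpolyC n K) (rho p) by move=> r; apply: mulrC.
pose iota : {rmorphism {poly K} -> E} := horner_morph cp.
have iotaE g : iota g = rho (map_poly (@mpolyC n K) g).[p].
  by rewrite -horner_map -map_poly_comp.
apply: boolp.contrapT => none.
have tr (g : {poly K}) : g != 0 -> iota g != 0.
  move=> g0; apply/negP => /eqP ig; apply: none.
  exists ((lead_coef g)^-1 *: g).
    by apply/monicP; rewrite lead_coefZ mulVf // lead_coef_eq0.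
  by apply/rhoP; rewrite -[LHS]iotaE -mul_polyC rmorphM ig mulr0.
have [||g g0 gP] := @zariski E _ [seq rho 'X_i | i <- enum 'I_n] _ iota.
- by move=> x x0; exists x^-1; rewrite divff.
- move=> A A1 A2 A3 A4 y; have [q <-] := rho_surj y; have [{}q <-] := pi_surj q.
  have AC c : A (rho c%:MP).
    by have := A1 c%:P; rewrite iotaE map_polyC hornerC.
  rewrite -[rho0 _]/(rho q); elim/mpolyind: q => [|c m' q _ _ IH].
    by rewrite -mpolyC0.
  rewrite rmorphD; apply: (A3) => //; rewrite -mul_mpolyC rmorphM; apply: (A4) => //.
  rewrite mpolyXE_id rmorph_prod; elim/big_ind: _ => [|u v Au Av|i _].
  - by rewrite -(rmorph1 rho) -mpolyC1.
  - exact: A4.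
  - rewrite rmorphXn; elim: (m' i) => [|k IHk].
      by rewrite expr0 -(rmorph1 rho) -mpolyC1.
    by rewrite exprS; apply: (A4) => //; apply: A2; apply: map_f; rewrite mem_enum.
have gn0 : g != 0 by apply: contraNneq g0 => ->; rewrite rmorph0.
have h0 : 1 + 'X * g != 0 by rewrite -size_poly_eq0 size_1XG.
have [c [N e]] := gP _ (tr _ h0).
apply: (@coprime_1XG _ g c N gn0); apply/eqP; rewrite -subr_eq0.
by apply: contraT => /tr; rewrite rmorphB rmorphM rmorphXn e subrr eqxx.
Qed.

End Nullstellensatz.

(** * Heights *)

Section AlgebraicDependence.
Variables (K : fieldType) (n : nat).
Local Notation S := {mpoly K[n]}.
Implicit Types (F : {set 'I_n}) (p q : S).

Definition vars_deg F k p := forall m, m \in msupp p -> msupport m \subset F /\ (mdeg m <= k)%N.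

Lemma vars_deg1 F : vars_deg F 0 1.
Proof. by move=> m; rewrite msupp1 inE => /eqP->; rewrite msupport0 sub0set mdeg0. Qed.

Lemma vars_degM F j k p q : vars_deg F j p -> vars_deg F k q -> vars_deg F (j + k) (p * q).
Proof.
move=> Hp Hq m /msuppM_le /allpairsP[[a b] /= [/Hp[aF aj] /Hq[bF bk] ->]].
by rewrite msupportD subUset aF bF mdegD leq_add.
Qed.

Lemma vars_degW F j k p : (j <= k)%N -> vars_deg F j p -> vars_deg F k p.
Proof. by move=> jk Hp m /Hp[mF mj]; split => //; apply: leq_trans jk. Qed.

Lemma vars_degX F k p i : vars_deg F k p -> vars_deg F (i * k) (p ^+ i).
Proof.
move=> Hp; elim: i => [|i IH]; first by rewrite expr0; apply: vars_deg1.
by rewrite exprS mulSn; apply: vars_degM.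
Qed.

Lemma algebraic_dependence F l (f : 'I_l -> S) :
  (forall i m, m \in msupp (f i) -> msupport m \subset F) -> (#|F| < l)%N ->
  exists N (g : {ffun 'I_l -> 'I_N} -> K), (exists a, g a != 0) /\
    \sum_a (g a)%:MP * \prod_i f i ^+ a i = 0.
Proof.
move=> fF Fl; pose D := \max_i msize (f i).
have fD i : vars_deg F D (f i).
  move=> m mf; split; first exact: fF mf.
  by apply: leq_trans (ltnW (msize_mdeg_lt mf)) _; apply: leq_bigmax.
(* N - 1 = (l D + 1)^|F| gives (N (l D + 1))^|F| < N^(|F|+1): there are fewer monomials than power
   products of the f_i with exponents below N. *)
pose N := ((l * D).+1 ^ #|F|).+1; pose B := (N * (l * D)).+1.
pose A := {ffun 'I_l -> 'I_N}; pose X := {ffun {i | i \in F} -> 'I_B}.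
pose mon (b : X) : 'X_{1..n} :=
  [multinom (if insub i is Some j then b j : nat else 0%N) | i < n].
pose pw (a : A) : S := \prod_i f i ^+ a i.
have pwD a : vars_deg F (N * (l * D)) (pw a).
  have : vars_deg F (\sum_(i < l) a i * D) (pw a).
    by rewrite /pw; elim/big_rec2: _ => [|i y k _]; [exact: vars_deg1 | apply/vars_degM/vars_degX].
  apply: vars_degW; rewrite mulnCA -[l in leqRHS]card_ord -sum_nat_const leq_sum //.
  by move=> i _; rewrite leq_mul2r (ltnW (ltn_ord _)) orbT.
have card_lt : (#|X| < #|A|)%N.
  rewrite !card_ffun !card_ord card_sig.
  have -> : #|[pred i | i \in F]| = #|F| by apply: eq_card.
  apply: leq_trans (leq_pexp2l (ltn0Sn _) Fl); rewrite expnS.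
  apply: (@leq_ltn_trans ((N * (l * D).+1) ^ #|F|)).
    have BN : (B <= N * (l * D).+1)%N by rewrite mulnS /B -add1n leq_add2r.
    by case: (posnP #|F|) => [->|F0]; rewrite ?expn0 // leq_exp2r.
  by rewrite expnMn mulnC ltn_pmul2r ?expn_gt0.
pose M := \matrix_(r < #|A|, c < #|X|) (pw (enum_val r))@_(mon (enum_val c)).
have : kermx M != 0.
  rewrite kermx_eq0 -row_leq_rank -ltnNge; apply: leq_ltn_trans card_lt.
  exact: rank_leq_col.
move=> /rowV0Pn[v /sub_kermxP vM v0].
exists N, (fun a => v 0 (enum_rank a)); split.
  have /rV0Pn[r vr] := v0; exists (enum_val r); by rewrite enum_valK.
apply/mpolyP => m; rewrite mcoeff0 raddf_sum /=.
rewrite (eq_bigr (fun a => v 0 (enum_rank a) * (pw a)@_m)); last first.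
  by move=> a _; rewrite mcoeffCM.
case: (boolP ((msupport m \subset F) && (mdeg m <= N * (l * D))%N)) => [/andP[mF mN]|]; last first.
  rewrite negb_and => H; rewrite big1 // => a _; apply/eqP; rewrite mulf_eq0; apply/orP; right.
  rewrite mcoeff_eq0; apply: contraL H => /pwD[-> ->] //.
have [b mb] : exists b : X, mon b = m.
  have mB i : (m i < B)%N.
    by rewrite ltnS; apply: leq_trans mN; rewrite mdegE (bigD1 i) //= leq_addr.
  exists [ffun j => Ordinal (mB (val j))]; apply/mnmP => i; rewrite mnmE.
  case: insubP => [j _ ji|iF]; first by rewrite ffunE /= ji.
  by apply/esym/eqP/negPn/negP => mi; case/negP: iF; apply: (subsetP mF); rewrite inE.
have /rowP/(_ (enum_rank b)) := vM; rewrite !mxE => e.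
rewrite -[RHS]e (reindex (fun r : 'I_#|A| => enum_val r)) /=; last exact/onW_bij/enum_val_bij.
by apply: eq_bigr => r _; rewrite mxE enum_valK enum_rankK mb.
Qed.

End AlgebraicDependence.

Section HeightBound.
Variables (K : fieldType) (n : nat) (Q : comNzRingType) (pi : {rmorphism {mpoly K[n]} -> Q}).
Local Notation S := {mpoly K[n]}.
Hypothesis pi_surj : forall q, exists p, pi p = q.
Variable D : {set {set 'I_n}}.
Hypothesis pi_ker : forall p, face_ideal D p -> pi p = 0.

Lemma pi_const_notin (P : {pred Q}) (c : K) : prime_ideal P -> c != 0 -> pi c%:MP \notin P.
Proof.
move=> [idP _] c0; have [_ _ PM] := idealr_closedP idP; apply/negP => cP.
have := PM (pi (c^-1)%:MP) _ cP; rewrite -rmorphM -mpolyCM mulVf // mpolyC1 rmorph1.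
by apply/negP; case: idP.
Qed.

Lemma chain_independent l (P : {pred Q}) (c : nat -> {pred Q}) (f : 'I_l -> S) N
    (g : {ffun 'I_l -> 'I_N} -> K) : prime_chain_to P l c ->
  (forall i : 'I_l, pi (f i) \in c i.+1 /\ pi (f i) \notin c i) ->
  pi (\sum_a (g a)%:MP * \prod_i f i ^+ a i) \in c 0%N -> forall a, g a = 0.
Proof.
move=> [cp cs _] fc.
have cI i : (i <= l)%N -> ideal (fun x => x \in c i) by move=> il; apply/idealr_closedP/(cp i il).1.
have transport (x y : S) j : x = y -> pi x \in c j -> pi y \in c j by move=> ->.
move=> sum0 a0; apply/eqP/negPn/negP => ga0.
(* Lowest terms: stage j keeps the exponents minimal, lexicographically, in
   the first j coordinates and divides out the corresponding factors. *)
have H j : (j <= l)%N -> exists A : {set {ffun 'I_l -> 'I_N}},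
    [/\ A != set0, forall a, a \in A -> g a != 0,
      forall a b (i : 'I_l), a \in A -> b \in A -> (i < j)%N -> a i = b i &
      pi (\sum_(a in A) (g a)%:MP * \prod_(i : 'I_l | (j <= i)%N) f i ^+ a i) \in c j].
  elim: j => [_|j IH jl].
    exists [set a | g a != 0]; split=> // [||].
    - by apply/set0Pn; exists a0; rewrite inE.
    - by move=> a; rewrite inE.
    - apply: transport sum0; rewrite (bigID (fun a => g a != 0)) /= [X in _ + X]big1.
        rewrite addr0; apply: eq_big => [a|a _]; first by rewrite inE.
        by congr (_ * _); apply: eq_bigl.
      by move=> a /negPn/eqP->; rewrite mpolyC0 mul0r.
  have [A [/set0Pn[a1 a1A] Ag Aeq Aj]] := IH (ltnW jl).
  pose oj := Ordinal jl; have [fj1 fj0] := fc oj.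
  case: (@arg_minnP _ a1 (mem A) (fun a => a oj) a1A) => a2.
  rewrite -[mem A a2]/(a2 \in A) => a2A amin.
  pose r := nat_of_ord (a2 oj).
  pose tail a : S := (g a)%:MP * \prod_(i : 'I_l | (j < i)%N) f i ^+ a i.
  have splitj a : (g a)%:MP * \prod_(i : 'I_l | (j <= i)%N) f i ^+ a i = f oj ^+ a oj * tail a.
    rewrite (bigD1 oj) //= mulrCA; congr (_ * (_ * _)); apply: eq_bigl => i.
    by rewrite [RHS]ltn_neqAle andbC eq_sym.
  (* All exponents of f_j are at least r and f_j lies outside the prime c_j, so f_j^r cancels. Terms
     with a larger exponent keep a factor f_j, which lies in c_(j+1); only the minimal ones
     survive. *)
  have Aj' : pi (\sum_(a in A) f oj ^+ (a oj - r) * tail a) \in c j.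
    have : pi (f oj) ^+ r * pi (\sum_(a in A) f oj ^+ (a oj - r) * tail a) \in c j.
      rewrite -rmorphXn -rmorphM mulr_sumr; apply: transport Aj; apply: eq_bigr => a aA.
      by rewrite splitj [RHS]mulrA -exprD subnKC // amin.
    have [_ prj] := cp j (ltnW jl).
    elim: (r in pi (f oj) ^+ r) => [|r' IHr]; first by rewrite expr0 mul1r.
    by rewrite exprS -mulrA => /prj/orP[/negPn|//]; rewrite fj0.
  have [_ cD cM] := cI j.+1 jl.
  exists [set a in A | a oj == a2 oj]; split.
  - by apply/set0Pn; exists a2; rewrite inE a2A eqxx.
  - by move=> a; rewrite inE => /andP[/Ag].
  - move=> a b i; rewrite !inE => /andP[aA /eqP aj] /andP[bA /eqP bj].
    rewrite ltnS leq_eqVlt => /orP[/eqP ij|ij]; last exact: Aeq.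
    by have -> : i = oj by [apply: val_inj]; rewrite aj bj.
  - have [sub _] := cs j jl; have := sub _ Aj'.
    rewrite (bigID (fun a : {ffun 'I_l -> 'I_N} => a oj == a2 oj)) /= rmorphD.
    set X := pi _; set Y := pi _; move=> XY.
    have Yc : Y \in c j.+1.
      rewrite /Y rmorph_sum; apply: ideal_sum (cI _ jl) _ => a /andP[aA aj].
      rewrite rmorphM mulrC; apply: (cM); rewrite rmorphXn.
      have : (0 < a oj - r)%N by rewrite subn_gt0 ltn_neqAle amin // andbT eq_sym.
      by case: (a oj - r)%N => // k _; rewrite exprSr; apply: cM.
    have Xc : X \in c j.+1 by have := idealB (cI _ jl) XY Yc; rewrite addrK.
    apply: transport Xc; apply: eq_big => [a|a /andP[_ /eqP aj]].
      by rewrite !inE.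
    by rewrite aj subnn expr0 mul1r.
have [A [/set0Pn[a aA] Ag Aeq]] := H l (leqnn l).
have -> : A = [set a].
  apply/setP => b; rewrite inE; apply/idP/eqP => [bA|->//].
  by apply/ffunP => i; apply: Aeq.
rewrite big_set1 big_pred0 ?mulr1; last by move=> i; rewrite leqNgt ltn_ord.
by apply/negP/pi_const_notin; [apply: cp | apply: Ag].
Qed.

(** The variables outside the lowest prime c_0 form a face F. Modulo c_0, elements separating
    consecutive primes can be taken in the variables of F, where more than |F| of them are
    algebraically dependent, against [chain_independent]. *)
Lemma height_bound e (P : {pred Q}) l c : (forall s, s \in D -> (#|s| <= e)%N) ->
  prime_chain_to P l c -> (l <= e)%N.
Proof.
move=> De pc; have [cp cs _] := pc.
have [id0 pr0] := cp 0%N isT; have i0 := idealr_closedP id0.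
pose F := [set i | pi 'X_i \notin c 0%N].
have FD : F \in D.
  apply/negPn/negP => /(face_ideal_xset K _ _)/pi_ker F0.
  have : pi (xset K F) \notin c 0%N.
    rewrite /xset mpolyXE_id rmorph_prod.
    elim/big_ind: _ => [|x y nx ny|i _].
    - by case: id0.
    - by apply/negP => /pr0; rewrite (negbTE nx) (negbTE ny).
    - rewrite mnmE; case: (boolP (i \in F)) => [|_]; first by rewrite inE expr1.
      by rewrite expr0 rmorph1; case: id0.
  by rewrite F0; case: i0 => ->.
apply: leq_trans (De _ FD); rewrite leqNgt; apply/negP => Fl.
have pick (i : 'I_l) : exists q : S, [/\ forall m, m \in msupp q -> msupport m \subset F,
    pi q \in c i.+1 & pi q \notin c i].
  have [sub nsub] := cs i (ltn_ord i).
  have [q [q1 q0]] : exists q, q \in c i.+1 /\ q \notin c i.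
    apply: boolp.contrapT => none; apply: nsub => q q1.
    by apply/negPn/negP => q0; apply: none; exists q.
  have [p pq] := pi_surj q.
  pose p' : S := \sum_(m <- msupp p | msupport m \subset F) p@_m *: 'X_[m].
  have sub0 j : (j <= l)%N -> {subset c 0%N <= c j}.
    elim: j => [_ x //|j IH] jl x /(IH (ltnW jl)); exact: (cs j jl).1.
  have pp' : pi (p - p') \in c 0%N.
    rewrite [p in p - _]mpolyE (bigID (fun m => msupport m \subset F)) /= -/p' addrAC subrr add0r.
    rewrite rmorph_sum; have i0' := i0; apply: ideal_sum i0' _ => m /subsetPn[j jm jF].
    rewrite -mul_mpolyC rmorphM; case: i0 => _ _ M0; apply: (M0).
    have /(@xset_mem K)[q' ->] : [set j] \subset msupport m by rewrite sub1set.
    rewrite xset1 rmorphM; apply: M0; move: jF; rewrite inE negbK //.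
  exists p'; split.
  - move=> m; rewrite mcoeff_msupp /p' raddf_sum; apply: contraR => mF.
    rewrite big1 // => m' m'F; rewrite /= mcoeffZ mcoeffX.
    by case: eqP m'F => [->|_ _]; [rewrite (negbTE mF) | rewrite mulr0].
  - have := idealB (idealr_closedP (cp _ (ltn_ord i)).1) q1 (sub0 _ (ltn_ord i) _ pp').
    by rewrite -pq -rmorphB opprB addrC subrK.
  - apply: contra q0 => p'i; have [_ cD _] := idealr_closedP (cp _ (ltnW (ltn_ord i))).1.
    by have := cD _ _ p'i (sub0 _ (ltnW (ltn_ord i)) _ pp'); rewrite -rmorphD addrC subrK pq.
have [f fP] := boolp.choice pick.
have [|N [g [[a ga] e0]]] := @algebraic_dependence _ _ F l f _ Fl.
  by move=> i; case: (fP i).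
case/eqP: ga; apply: (chain_independent (f := f) pc) => [i|].
  by case: (fP i).
by rewrite e0 rmorph0; case: i0.
Qed.

End HeightBound.

(** * Presentation of the Stanley-Reisner ring *)

Section Presentation.
Variables (K : fieldType) (T : finType).
Local Notation n := #|T|.+1.
Implicit Types (D : {set {set T}}) (s t : {set T}).

(* One variable more than there are points in T, so that ord_max is a vertex of
   no complex on T. *)
Definition emb (v : T) : 'I_n := widen_ord (leqnSn _) (enum_rank v).

Lemma emb_inj : injective emb.
Proof. by move=> u v /(congr1 val) /= /val_inj/enum_rank_inj. Qed.

Definition emb_complex D : {set {set 'I_n}} := [set emb @: s | s : {set T} in D].

Lemma mem_emb_complex D s : (emb @: s \in emb_complex D) = (s \in D).
Proof. by apply: mem_imset; apply: imset_inj; apply: emb_inj. Qed.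

Lemma emb_subset s t : (emb @: s \subset emb @: t) = (s \subset t).
Proof.
apply/idP/idP => [/subsetP H|]; last exact: imsetS.
by apply/subsetP => v vs; have := H _ (imset_f emb vs); rewrite mem_imset //; apply: emb_inj.
Qed.

Lemma sub_emb (A : {set 'I_n}) s : A \subset emb @: s ->
  exists2 t : {set T}, t \subset s & A = emb @: t.
Proof.
move=> As; exists [set v | emb v \in A].
  rewrite -emb_subset; apply: subset_trans As; apply/subsetP => i /imsetP[v].
  by rewrite inE => ? ->.
apply/setP => i; apply/idP/imsetP => [iA|[v]]; last by rewrite inE => vA ->.
have /imsetP[v vs iE] := subsetP As _ iA.
by exists v; rewrite // inE -iE.
Qed.

Lemma downward_emb D : simplicial_complex D -> downward (emb_complex D).
Proof.
move=> [_ dD] A B /imsetP[s sD ->] /sub_emb[t ts ->].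
by rewrite mem_emb_complex; apply: dD ts.
Qed.

Section Complex.
Variables (D : {set {set T}}) (cD : simplicial_complex D).
Local Notation V := (vertices D).
Local Notation S := {mpoly K[n]}.
Local Notation SV := {mpoly K[#|V|]}.

(** The sum has one term if i comes from a vertex of D and none otherwise, so all other variables
    are killed. *)
Definition to_sr : S -> SV :=
  mmap (@mpolyC _ K) (fun i => \sum_(a < #|V| | emb (enum_val a) == i) 'X_a).
Definition of_sr : SV -> S := mmap (@mpolyC _ K) (fun a => 'X_(emb (enum_val a))).

HB.instance Definition _ := GRing.RMorphism.on to_sr.
HB.instance Definition _ := GRing.RMorphism.on of_sr.

Lemma to_srX i : to_sr 'X_i = \sum_(a < #|V| | emb (enum_val a) == i) 'X_a.
Proof. by rewrite /to_sr mmapX mmap1U. Qed.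

Lemma of_srX a : of_sr 'X_a = 'X_(emb (enum_val a)).
Proof. by rewrite /of_sr mmapX mmap1U. Qed.

Lemma to_srC c : to_sr c%:MP = c%:MP. Proof. exact: mmapC. Qed.
Lemma of_srC c : of_sr c%:MP = c%:MP. Proof. exact: mmapC. Qed.
Lemma to_srM : {morph to_sr : p q / p * q}. Proof. exact: rmorphM. Qed.
Lemma of_srM : {morph of_sr : p q / p * q}. Proof. exact: rmorphM. Qed.
Lemma to_srD : {morph to_sr : p q / p + q}. Proof. exact: rmorphD. Qed.
Lemma of_srD : {morph of_sr : p q / p + q}. Proof. exact: rmorphD. Qed.
Lemma to_sr0 : to_sr 0 = 0. Proof. exact: rmorph0. Qed.
Lemma of_sr0 : of_sr 0 = 0. Proof. exact: rmorph0. Qed.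
Lemma to_sr1 : to_sr 1 = 1. Proof. exact: rmorph1. Qed.
Lemma of_sr1 : of_sr 1 = 1. Proof. exact: rmorph1. Qed.

Lemma to_sr_emb a : to_sr 'X_(emb (enum_val a)) = 'X_a.
Proof.
rewrite to_srX (big_pred1 a) // => b.
by rewrite (inj_eq emb_inj) (inj_eq enum_val_inj).
Qed.

Local Opaque to_sr of_sr.

Lemma mpoly_morph_mod k (f g : {mpoly K[k]} -> S) (W : S -> Prop) : ideal W ->
  f 0 = 0 -> g 0 = 0 -> {morph f : p q / p + q} -> {morph g : p q / p + q} ->
  f 1 = 1 -> g 1 = 1 -> {morph f : p q / p * q} -> {morph g : p q / p * q} ->
  (forall c, f c%:MP = g c%:MP) -> (forall i, W (f 'X_i - g 'X_i)) -> forall p, W (f p - g p).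
Proof.
move=> [W0 WD WM] f0 g0 fD gD f1 g1 fM gM fgC fgX.
have WMM p q : W (f p - g p) -> W (f q - g q) -> W (f (p * q) - g (p * q)).
  move=> Wp Wq; rewrite fM gM.
  have -> : f p * f q - g p * g q = f q * (f p - g p) + g p * (f q - g q) by ring.
  by apply: WD; apply: WM.
elim/mpolyind => [|c m p _ _ IH]; first by rewrite f0 g0 subrr.
rewrite fD gD opprD addrACA; apply: (WD) IH; rewrite -mul_mpolyC.
apply: (WMM); first by rewrite fgC subrr.
rewrite mpolyXE_id; elim/big_ind: _ => [|u v|i _]; [by rewrite f1 g1 subrr | exact: WMM |].
by elim: (m i) => [|j IHj]; [rewrite expr0 f1 g1 subrr | rewrite exprS; apply: WMM].
Qed.

Lemma of_srK q : to_sr (of_sr q) = q.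
Proof.
elim/mpolyind: q => [|c m p _ _ IH]; first by rewrite of_sr0 to_sr0.
rewrite of_srD to_srD IH -mul_mpolyC of_srM to_srM of_srC to_srC.
suff -> : to_sr (of_sr 'X_[m]) = 'X_[m] by [].
rewrite mpolyXE_id; elim/big_ind: _ => [|u v Hu Hv|i _].
- by rewrite of_sr1 to_sr1.
- by rewrite of_srM to_srM Hu Hv.
- elim: (m i) => [|j IHj]; first by rewrite expr0 of_sr1 to_sr1.
  by rewrite exprS of_srM to_srM IHj of_srX to_sr_emb.
Qed.

Lemma to_srK p : face_ideal (emb_complex D) (of_sr (to_sr p) - p).
Proof.
have iD := face_idealP K (downward_emb cD).
apply: (mpoly_morph_mod (f := of_sr \o to_sr) (g := id) iD) => //=.
- by rewrite to_sr0 of_sr0.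
- by move=> u v /=; rewrite to_srD of_srD.
- by rewrite to_sr1 of_sr1.
- by move=> u v /=; rewrite to_srM of_srM.
- by move=> c; rewrite to_srC of_srC.
- move=> i; case: (boolP (i \in emb @: V)) => [/imsetP[v vV ->]|iV].
    by rewrite -(enum_rankK_in vV vV) to_sr_emb of_srX subrr; case: iD.
  rewrite to_srX big_pred0 ?of_sr0 ?sub0r; last first.
    move=> a; apply: contraNF iV => /eqP <-; apply: imset_f; exact: enum_valP.
  apply: (idealN iD); apply/face_idealX; rewrite msupportU; apply: contra iV => /imsetP[s sD iE].
  have : i \in emb @: s by rewrite -iE inE.
  move=> /imsetP[v vs ->]; apply: imset_f; rewrite inE; case: cD => _ dD.
  by apply: dD sD _; rewrite sub1set.
Qed.

Lemma of_sr_face s : s \subset V -> of_sr (face_monomial K D s) = xset K (emb @: s).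
Proof.
move=> sV; rewrite /face_monomial.
have -> : of_sr (\prod_(i < #|V| | enum_val i \in s) 'X_i) =
    \prod_(i < #|V| | enum_val i \in s) of_sr 'X_i.
  by apply: big_morph; [exact: of_srM | exact: of_sr1].
rewrite /xset mpolyXE_id.
transitivity (\prod_(i in emb @: s) ('X_i : S)); last first.
  rewrite [RHS](bigID (fun i => i \in emb @: s)) /= [X in _ * X]big1 ?mulr1.
    by apply: eq_bigr => i iS; rewrite mnmE iS expr1.
  by move=> i iS; rewrite mnmE (negbTE iS) expr0.
rewrite big_imset /=; last by move=> u v _ _; apply: emb_inj.
under eq_bigr do rewrite of_srX.
rewrite -(big_enum_val_cond (A := mem V) (fun v => v \in s) (fun v => 'X_(emb v) : S)) /=.
by apply: eq_bigl => v; case: (boolP (v \in s)) => [/(subsetP sV)->|_]; rewrite ?andbF.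
Qed.

(** All complexes on T are presented over the same polynomial ring, so that the ideals of complexes
    with different vertex sets can be compared. *)
Lemma sr_presentation : exists pi : {rmorphism S -> stanley_reisner_ring K D},
  (forall q, exists p, pi p = q) /\ (forall p, face_ideal (emb_complex D) p <-> pi p = 0).
Proof.
have iD := face_idealP K (downward_emb cD).
pose pi0 : {rmorphism SV -> stanley_reisner_ring K D} := \pi_(stanley_reisner_ring K D)%qT.
have pi00 q : pi0 q = 0 <-> q \in (@sr_ideal K T D).
  have -> : (q \in (@sr_ideal K T D)) = (pi0 q == pi0 0).
    by rewrite -[q in LHS]subr0; exact: (@Quotient.idealrBE SV ((@sr_ideal K T D)) q 0).
  by rewrite rmorph0; split=> /eqP.
pose pi : {rmorphism S -> stanley_reisner_ring K D} := pi0 \o to_sr.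
exists pi; split=> [y|p].
  by exists (of_sr (repr y)); rewrite /= of_srK; apply: reprK.
have -> : pi p = 0 <-> to_sr p \in (@sr_ideal K T D) by exact: pi00.
split=> [Dp|/boolp.asboolP[c pE]]; last first.
  rewrite -[p](subKr (of_sr (to_sr p))); apply: (idealB iD); last exact: to_srK.
  rewrite pE.
  have -> : of_sr (\sum_(s | nonface D s) c s * face_monomial K D s) =
      \sum_(s | nonface D s) of_sr (c s * face_monomial K D s).
    by apply: big_morph; [exact: of_srD | exact: of_sr0].
  apply: ideal_sum => // s /and3P[sV sD _]; rewrite of_srM of_sr_face //.
  by case: iD => _ _; apply; apply/face_ideal_xset; rewrite mem_emb_complex.
have iS := idealr_closedP (@sr_ideal_closed K T D).
suff H m : m \in msupp p -> to_sr 'X_[m] \in (@sr_ideal K T D).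
  rewrite [p]mpolyE big_seq.
  have -> : to_sr (\sum_(m <- msupp p | m \in msupp p) p@_m *: 'X_[m]) =
      \sum_(m <- msupp p | m \in msupp p) to_sr (p@_m *: 'X_[m]).
    by apply: big_morph; [exact: to_srD | exact: to_sr0].
  have iS' := iS; apply: ideal_sum iS' _ => m mp.
  by rewrite -mul_mpolyC to_srM; case: iS => _ _; apply; apply: H.
move=> /(face_ideal_supp Dp) mD.
case: (boolP (msupport m \subset emb @: V)) => [/sub_emb[s sV ms]|/subsetPn[i im iV]].
  have /(@xset_mem K)[q ->] := subxx (msupport m).
  rewrite to_srM ms -of_sr_face // of_srK; case: (iS) => _ _; apply.
  apply/boolp.asboolP; exists (fun t => (t == s)%:R).
  have sN : nonface D s.
    rewrite /nonface sV -mem_emb_complex -ms mD /=.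
    by apply: contraNneq mD => s0; rewrite ms s0 imset0 -(imset0 emb) mem_emb_complex; case: cD.
  rewrite (bigD1 s) //= eqxx mul1r big1 ?addr0 // => t /andP[_ ts].
  by rewrite (negbTE ts) mul0r.
have /(@xset_mem K)[q ->] : [set i] \subset msupport m by rewrite sub1set.
rewrite xset1 to_srM to_srX big_pred0 ?mulr0; first by case: iS.
by move=> a; apply: contraNF iV => /eqP <-; apply: imset_f; exact: enum_valP.
Qed.

End Complex.
End Presentation.

(** * From Cohen-Macaulay to acyclic and back *)

(** Q2 is a quotient of Q1, along which ideals pull back; the ring of a subcomplex inherits
    noetherianity in this way. *)
Lemma noetherian_quotient (S Q1 Q2 : comNzRingType) (pi1 : {rmorphism S -> Q1})
    (pi2 : {rmorphism S -> Q2}) :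
  (forall q, exists p, pi1 p = q) -> (forall q, exists p, pi2 p = q) ->
  (forall p, pi1 p = 0 -> pi2 p = 0) -> noetherian Q1 -> noetherian Q2.
Proof.
move=> surj1 surj2 ker12 noeth I idI; have iI := idealr_closedP idI.
pose I1 : {pred Q1} := fun q => boolp.asbool (exists2 p, pi1 p = q & pi2 p \in I).
have I1E p : pi1 p \in I1 <-> pi2 p \in I.
  split=> [/boolp.asboolP[p' e p'I]|pI]; last by apply/boolp.asboolP; exists p.
  suff -> : pi2 p = pi2 p' by [].
  by apply/eqP; rewrite -subr_eq0 -rmorphB ker12 // rmorphB e subrr.
have I1E' q : q \in I1 <-> exists2 p, pi1 p = q & pi2 p \in I.
  by split=> [/boolp.asboolP|?]; last exact/boolp.asboolP.
have idI1 : idealr_closed I1.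
  case: (iI) => I0 ID IM; apply: ideal_idealr_closed I1E' _ _.
    split.
    - by exists 0; rewrite ?rmorph0.
    - move=> _ _ [p <- pI] [q <- qI]; exists (p + q); rewrite rmorphD //; exact: ID.
    - move=> r _ [p <- pI]; have [r' <-] := surj1 r.
      by exists (r' * p); rewrite rmorphM //; apply: IM.
  case=> p p1 pI; have /I1E : pi1 1 \in I1 by rewrite rmorph1 -p1; apply/I1E.
  by rewrite rmorph1; apply/negP; case: idI.
have [s1 s1P] := noeth I1 idI1.
have [a aE] : exists a, map pi1 a = s1.
  elim: s1 {s1P} => [|q s1 [a <-]]; first by exists [::].
  by have [p <-] := surj1 q; exists (p :: a).
exists (map pi2 a) => q; have [p <-] := surj2 q; split=> [/I1E/s1P|].
  rewrite -aE => /(in_span_map surj1) H; apply/(in_span_map surj2).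
  exact: ideal_adds_mono H.
apply: in_span_min iI _ => _ /mapP[b ba ->]; apply/I1E/s1P; rewrite -aE.
exact/mem_in_span/map_f.
Qed.

Section RegularAtPoint.
Variables (K : fieldType) (n : nat) (Q : comNzRingType) (pi : {rmorphism {mpoly K[n]} -> Q}).
Local Notation S := {mpoly K[n]}.
Hypothesis pi_surj : forall q, exists p, pi p = q.
Variables (L : {set {set 'I_n}}) (F : {set 'I_n}) (pt : 'I_n -> K).
Hypothesis pi_ker : forall p, face_ideal L p <-> pi p = 0.
Hypotheses (dL : downward L) (FL : F \in L) (ptF : forall i, i \notin F -> pt i = 0).

(** For k = 0, ..., |F| the kernels give a chain of primes of Q, from the component of the face F up
    to the maximal ideal of the point [pt]. *)
Definition partial_eval (k : nat) : S -> S :=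
  mmap (@mpolyC n K) (fun i => if i \notin F then 0
    else if (index i (enum F) < k)%N then (pt i)%:MP else 'X_i).

Lemma partial_evalX k i : partial_eval k 'X_i = if i \notin F then 0
    else if (index i (enum F) < k)%N then (pt i)%:MP else 'X_i.
Proof. by rewrite /partial_eval mmapX mmap1U. Qed.

Lemma partial_evalC k c : partial_eval k c%:MP = c%:MP. Proof. exact: mmapC. Qed.
Lemma partial_evalM k : {morph partial_eval k : p q / p * q}. Proof. exact: rmorphM. Qed.
Lemma partial_evalD k : {morph partial_eval k : p q / p + q}. Proof. exact: mmapD. Qed.
Lemma partial_evalB k : {morph partial_eval k : p q / p - q}. Proof. exact: mmapB. Qed.
Lemma partial_eval0 k : partial_eval k 0 = 0. Proof. exact: mmap0. Qed.
Lemma partial_eval1 k : partial_eval k 1 = 1. Proof. by rewrite -mpolyC1 partial_evalC. Qed.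

Local Opaque partial_eval.

Lemma partial_eval_ker k p : pi p = 0 -> partial_eval k p = 0.
Proof.
move=> /pi_ker Lp; rewrite [p]mpolyE big_seq.
have -> : partial_eval k (\sum_(m <- msupp p | m \in msupp p) p@_m *: 'X_[m]) =
    \sum_(m <- msupp p | m \in msupp p) partial_eval k (p@_m *: 'X_[m]).
  by apply: big_morph; [exact: partial_evalD | exact: partial_eval0].
rewrite big1 // => m /(face_ideal_supp Lp) mL.
have /subsetPn[i im iF] : ~~ (msupport m \subset F).
  by apply: contra mL; apply: dL FL.
have /(@xset_mem K)[q ->] : [set i] \subset msupport m by rewrite sub1set.
by rewrite -mul_mpolyC xset1 !partial_evalM partial_evalX iF !mulr0.
Qed.

Lemma partial_eval_step k p : partial_eval k.+1 (partial_eval k p) = partial_eval k.+1 p.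
Proof.
elim/mpolyind: p => [|c m p _ _ IH]; first by rewrite !partial_eval0.
rewrite -mul_mpolyC !partial_evalD !partial_evalM !partial_evalC IH.
suff -> : partial_eval k.+1 (partial_eval k 'X_[m]) = partial_eval k.+1 'X_[m] by [].
rewrite mpolyXE_id; elim/big_ind: _ => [|u v Hu Hv|i _].
- by rewrite !partial_eval1.
- by rewrite !partial_evalM Hu Hv.
- elim: (m i) => [|j IHj]; first by rewrite expr0 !partial_eval1.
  rewrite exprS !partial_evalM IHj; congr (_ * _); rewrite !partial_evalX.
  case: ifP => iF; first exact: partial_eval0.
  by case: ltnP => ik; [rewrite partial_evalC ltnS ltnW | rewrite partial_evalX iF].
Qed.

Lemma partial_eval_full p : partial_eval #|F| p = (p.@[pt])%:MP.
Proof.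
elim/mpolyind: p => [|c m p _ _ IH]; first by rewrite partial_eval0 meval0 mpolyC0.
rewrite mevalD mevalZ mevalX mpolyCD mpolyCM -mul_mpolyC partial_evalD partial_evalM.
rewrite partial_evalC IH; congr (_ * _ + _).
rewrite mpolyXE_id; elim/big_ind2: _ => [|u v u' v' Hu Hv|i _].
- by rewrite partial_eval1 mpolyC1.
- by rewrite partial_evalM Hu Hv mpolyCM.
- elim: (m i) => [|j IHj]; first by rewrite !expr0 partial_eval1 mpolyC1.
  rewrite !exprS partial_evalM IHj mpolyCM; congr (_ * _); rewrite partial_evalX.
  case: (boolP (i \in F)) => iF /=; last by rewrite ptF // mpolyC0.
  by rewrite [#|F|]cardE index_mem mem_enum iF.
Qed.

Definition point_prime k : {pred Q} :=
  fun q => boolp.asbool (exists2 p, pi p = q & partial_eval k p = 0).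

Lemma mem_point_prime k p : pi p \in point_prime k <-> partial_eval k p = 0.
Proof.
split=> [/boolp.asboolP[p' e p'0]|p0]; last by apply/boolp.asboolP; exists p.
apply/eqP; rewrite -[p](subrK p') partial_evalD p'0 addr0; apply/eqP/partial_eval_ker.
by rewrite rmorphB e subrr.
Qed.

Lemma point_prime_prime k : prime_ideal (point_prime k).
Proof.
split.
  apply: (@ideal_idealr_closed _ (fun q => exists2 p, pi p = q & partial_eval k p = 0)).
  - by move=> q; split=> [/boolp.asboolP|?]; last exact/boolp.asboolP.
  - split.
    + by exists 0; rewrite ?rmorph0 ?partial_eval0.
    + move=> _ _ [p <- p0] [q <- q0]; exists (p + q); first exact: rmorphD.
      by rewrite partial_evalD p0 q0 addr0.
    + move=> r _ [p <- p0]; have [r' <-] := pi_surj r; exists (r' * p); first exact: rmorphM.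
      by rewrite partial_evalM p0 mulr0.
  - case=> p p1 p0; have : pi 1 \in point_prime k by rewrite rmorph1 -p1; apply/mem_point_prime.
    by move/mem_point_prime; rewrite partial_eval1 => /eqP; rewrite oner_eq0.
move=> u v; have [p <-] := pi_surj u; have [q <-] := pi_surj v; rewrite -rmorphM.
move=> /mem_point_prime/eqP; rewrite partial_evalM mulf_eq0.
by case/orP=> /eqP/mem_point_prime->; rewrite ?orbT.
Qed.

Lemma point_prime_chain : prime_chain_to (point_prime #|F|) #|F| point_prime.
Proof.
split=> // [i _|k kF]; first exact: point_prime_prime.
split=> [q|sub].
  have [p <-] := pi_surj q; move=> /mem_point_prime p0; apply/mem_point_prime.
  by rewrite -partial_eval_step p0 partial_eval0.
have /card_gt0P[i0 _] : (0 < #|F|)%N by apply: leq_trans kF.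
pose i := nth i0 (enum F) k.
have iF : i \in F by rewrite -mem_enum mem_nth // -cardE.
have ik : index i (enum F) = k by rewrite index_uniq ?enum_uniq // -cardE.
have /sub/mem_point_prime : pi ('X_i - (pt i)%:MP) \in point_prime k.+1.
  by apply/mem_point_prime; rewrite partial_evalB partial_evalC partial_evalX iF ik ltnSn subrr.
rewrite partial_evalB partial_evalC partial_evalX iF ik ltnn /=.
move=> /(congr1 (fun p => p@_U_(i))); rewrite mcoeffB mcoeffX eqxx mcoeffC mcoeff0.
by rewrite mnm1_eq0 mulr0 subr0 => /eqP; rewrite oner_eq0.
Qed.

Lemma point_prime_maximal : maximal_ideal (point_prime #|F|).
Proof.
split; first exact: (point_prime_prime _).1.
move=> J idJ subJ q; have [p <-] := pi_surj q => pJ; apply/mem_point_prime.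
rewrite partial_eval_full; have [J0 JD JM] := idealr_closedP idJ.
have cJ : pi (p.@[pt])%:MP \in J.
  have /subJ sJ : pi (p - (p.@[pt])%:MP) \in point_prime #|F|.
    by apply/mem_point_prime; rewrite partial_evalB partial_evalC partial_eval_full subrr.
  by have := idealB (idealr_closedP idJ) pJ sJ; rewrite -rmorphB subKr.
apply/eqP/negPn/negP; rewrite mpolyC_eq0 => p0.
have := JM (pi ((p.@[pt])^-1)%:MP) _ cJ; rewrite -rmorphM -mpolyCM mulVf // mpolyC1 rmorph1.
by apply/negP; case: idJ.
Qed.

(** The chain of point primes makes the height at [pt] at least |F|, and depth equals height; a
    longer regular sequence is cut after |F| elements. *)
Lemma regular_at_point : cohen_macaulay_ring Q ->
  exists a, [/\ regular_list (face_ideal L) a, size a = #|F| &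
    forall p, p \in a -> p.@[pt] = 0].
Proof.
move=> [_ /(_ _ point_prime_maximal) [h [[[s [[_ sreg] sm] sh] _] [_ hmax]]]].
have Fh := hmax _ _ point_prime_chain; rewrite -sh in Fh.
have [a [aE a0]] : exists a, map pi a = s /\ forall p, p \in a -> p.@[pt] = 0.
  elim: s sm {sreg sh Fh} => [|q s IH] sm; first by exists [::].
  have [r rs|a [<- a0]] := IH; first by apply: sm; rewrite inE rs orbT.
  have [p pq] := pi_surj q; exists (p :: a); split; first by rewrite /= pq.
  move=> p'; rewrite inE => /orP[/eqP->|]; last exact: a0.
  have : pi p \in point_prime #|F| by rewrite pq; apply: sm; rewrite mem_head.
  by move/mem_point_prime; rewrite partial_eval_full => /eqP; rewrite mpolyC_eq0 => /eqP.
exists (take #|F| a); split; last by move=> p /mem_take/a0.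
- apply: (@regular_list_eq _ (fun p => pi p = 0)) => [p|].
    by split=> /pi_ker.
  apply/regular_map => // i; rewrite size_take_min leq_min => /andP[iF ia] x.
  rewrite map_take aE take_takel ?(ltnW iF) // nth_take //; apply: sreg.
  by rewrite -aE size_map.
- by rewrite size_takel // -(size_map pi) aE.
Qed.

End RegularAtPoint.

Section FromAcyclic.
Variables (K : fieldType) (n : nat).
Local Notation S := {mpoly K[n]}.
Local Notation comp k := (pihomog [measure of mdeg] k).

Lemma face_ideal_homog (D : {set {set 'I_n}}) k (p : S) :
  face_ideal D p -> face_ideal D (comp k p).
Proof. by move=> Dp m mD; rewrite mcoeff_comp Dp // if_same. Qed.

Lemma elem_homog (x : 'I_n) i : elem K x i \is i.-homog.
Proof.
apply: rpred_sum => s /andP[/eqP si _].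
by rewrite /xset dhomogX /= mdeg_squarefree si.
Qed.

Lemma monic_leading (x : 'I_n) i (g : {poly K}) d : (0 < i)%N -> g \is monic -> size g = d.+1 ->
  (msize (map_poly (@mpolyC n K) g).[elem K x i] <= (i * d).+1)%N /\
  comp (i * d) (map_poly (@mpolyC n K) g).[elem K x i] = elem K x i ^+ d.
Proof.
move=> i0 gm gd; rewrite (@horner_map_wide _ _ _ d.+1) ?gd // big_ord_recr /=.
have -> : g`_d = 1 by have := monicP gm; rewrite lead_coefE gd.
rewrite mpolyC1 mul1r.
have hX j : elem K x i ^+ j \is (i * j).-homog by apply: dhomogMn; apply: elem_homog.
have small : (msize (\sum_(j < d) (g`_j)%:MP * elem K x i ^+ j) <= i * d)%N.
  apply/msize_leP => m md; rewrite raddf_sum big1 // => j _ /=.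
  rewrite mcoeffCM (dhomog_nemf_coeff (hX j)) ?mulr0 //.
  by apply: contraTneq md => ->; rewrite -ltnNge ltn_mul2l i0 ltn_ord.
split.
  apply: msize_add; first exact: leqW.
  apply/msize_leP => m md; rewrite (dhomog_nemf_coeff (hX d)) //.
  by apply: contraTneq md => ->; rewrite ltnn.
by rewrite raddfD /= (comp_small small) add0r pihomog_dE.
Qed.

Variables (Q : comNzRingType) (pi : {rmorphism S -> Q}).
Hypothesis pi_surj : forall q, exists p, pi p = q.
Variables (C : {set {set 'I_n}}) (x : 'I_n) (e : nat).
Hypothesis pi_ker : forall p, face_ideal C p <-> pi p = 0.
Hypotheses (dC : downward C) (Ce : forall s, s \in C -> (#|s| <= e)%N).
Hypothesis ac : forall d, acyclic (face_ideal C) (params K x e.+1 d) 1.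

(** Regularity at position i comes from H_1 of f_(i+1), ..., f_1 in every total degree k, whereas
    acyclicity is known for full lists of powers only; the free exponents in [ac] bridge this gap.
    With first parameter e+1, [params] has the e indices e, ..., 1. *)
Lemma monic_regular (g : nat -> {poly K}) : (forall i, g i \is monic) ->
  regular_list (face_ideal C)
    [seq (map_poly (@mpolyC n K) (g i)).[elem K x i] | i <- iota 1 e].
Proof.
move=> gm; have iC := face_idealP K dC.
pose d i := (size (g i)).-1.
have gd i : size (g i) = (d i).+1 by rewrite prednK // size_poly_gt0 monic_neq0.
pose f i := (map_poly (@mpolyC n K) (g i)).[elem K x i].
apply/(@regular_listP _ _ [::] _ iC) => i; rewrite size_map size_iota /= => ie.
have -> : [seq f i | i <- iota 1 e]`_i = f i.+1.
  by rewrite (nth_map 0%N) ?size_iota // nth_iota.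
rewrite -map_take take_iota (minn_idPl (ltnW ie)).
pose fs := [seq f j | j <- rev (iota 1 i)].
have sfs : size fs = i by rewrite size_map size_rev size_iota.
have H : regular_mod (ideal_adds (face_ideal C) fs) (f i.+1); last first.
  move=> p pI; have E : fs =i [seq f j | j <- iota 1 i].
    by move=> q; rewrite /fs map_rev mem_rev.
  by apply: (ideal_adds_perm iC E); apply: H; apply: ideal_adds_perm pI => // q; rewrite E.
pose ds := [seq (j * d j)%N | j <- rev (iota 1 i)].
apply: (bounded_acyclic_regular iC (h := (i.+1 * d i.+1)%N) (ds := ds)) => k.
rewrite sfs -[_ :: fs]/[seq f j | j <- i.+1 :: rev (iota 1 i)].
rewrite -[_ :: ds]/[seq (j * d j)%N | j <- i.+1 :: rev (iota 1 i)].
have -> : i.+1 :: rev (iota 1 i) = rev (iota 1 i.+1).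
  by have := iotaD 1 i 1; rewrite addn1 => ->; rewrite rev_cat.
(* The parameters beyond i + 1 are raised to so high a power that they cannot
   occur in a chain of degree < k. *)
pose hi := rev (iota i.+2 (e - i.+1)).
pose d' j := if (j <= i.+1)%N then d j else k.
have split_iota : rev (iota 1 e) = hi ++ rev (iota 1 i.+1).
  by rewrite -rev_cat -{1}(subnKC ie) iotaD add1n.
pose F j : S := if (j <= i.+1)%N then f j else elem K x j ^+ k.
apply: (@bounded_acyclic_catr _ _ _ iC [seq F j | j <- hi] [seq (j * d' j)%N | j <- hi]).
- by rewrite !size_map.
- move=> h /mapP[j]; rewrite mem_rev mem_iota => /andP[ij _] ->.
  by rewrite /d' [(j <= _)%N]leqNgt ij /= leq_pmull // (leq_trans _ ij).
have lowE (U : Type) (u v : nat -> U) : (forall j, (j <= i.+1)%N -> u j = v j) ->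
    [seq u j | j <- rev (iota 1 i.+1)] = [seq v j | j <- rev (iota 1 i.+1)].
  by move=> uv; apply/eq_in_map => j; rewrite mem_rev mem_iota add1n ltnS => /andP[_ /uv].
rewrite -(lowE _ F f); last by move=> j ji; rewrite /F ji.
rewrite -(lowE _ (fun j => j * d' j)%N); last by move=> j ji; rewrite /d' ji.
rewrite -!map_cat -split_iota.
have -> : (size [seq F j | j <- hi] + i.+1 = size (params K x e.+1 d'))%N.
  by rewrite !size_map !size_rev !size_iota subnK.
apply: leading_bounded_acyclic => // [k' p|]; first exact: face_ideal_homog.
move=> t; case: (ltnP t (size (rev (iota 1 e)))) => te; last first.
  by rewrite !nth_default ?size_map ?msize0 ?raddf0.
rewrite /params !(nth_map 0%N) //; set j := nth _ _ t.
have j0 : (0 < j)%N.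
  by have := mem_nth 0%N te; rewrite mem_rev mem_iota => /andP[].
rewrite /F /d'; case: ifP => ji; first by have [h1 <-] := monic_leading x j0 (gm j) (gd j).
have hX : elem K x j ^+ k \is (j * k).-homog by apply: dhomogMn; apply: elem_homog.
rewrite pihomog_dE //; split => //.
apply/msize_leP => m md; rewrite (dhomog_nemf_coeff hX) //.
by apply: contraTneq md => ->; rewrite ltnn.
Qed.

Lemma acyclic_cohen_macaulay : noetherian Q -> cohen_macaulay_ring Q.
Proof.
move=> noeth; split=> // m mm; have pm := maximal_prime mm.
have im := idealr_closedP mm.1.
have [g gP] := boolp.choice (fun i => let: ex_intro2 g gm gp :=
  maximal_algebraic pi_surj (elem K x i) mm in ex_intro _ g (conj gm gp)).
have reg := monic_regular (fun i => (gP i).1).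
set a := [seq _ | i <- _] in reg.
have sa : size (map pi a) = e by rewrite !size_map size_iota.
have am : {subset map pi a <= m}.
  by move=> q /mapP[p /mapP[i _ ->] ->]; apply: (gP i).2.
have reg' : regular_list (fun p => pi p = 0) a.
  by apply: regular_list_eq reg => p; rewrite pi_ker.
have regm s : {subset s <= m} -> ~ in_span s 1.
  by move=> sm /(in_span_min im sm); apply/negP; case: mm.1.
exists e; split; split.
- exists (map pi a) => //; split => //; split; first exact: regm.
  by move=> i; rewrite size_map; move/(regular_map pi_surj): reg'; apply.
- move=> s [[_ sreg] sm]; have [c pc] := regular_prime_chain pm sreg sm.
  exact: (height_bound pi_surj (fun p => (pi_ker p).1) Ce pc).
- rewrite -sa; apply: (regular_prime_chain pm) am => i; rewrite size_map.
  by move/(regular_map pi_surj): reg'; apply.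
- by move=> l c pc; exact: (height_bound pi_surj (fun p => (pi_ker p).1) Ce pc).
Qed.

End FromAcyclic.

(** * Deletion and skeleta *)

Section Shrink.
Variables (K : fieldType) (T : finType).
Implicit Types (D L : {set {set T}}) (s t : {set T}) (x : option T).

Definition pure_of_size D e :=
  simplicial_complex D /\
  forall s, s \in D -> exists F : {set T}, [/\ F \in D, s \subset F & #|F| = e].

Lemma pure_of_size_le D e s : pure_of_size D e -> s \in D -> (#|s| <= e)%N.
Proof. by move=> [_ H] /H[F [_ /subset_leq_card sF <-]]. Qed.

(** [None] lowers the skeleton without deleting a point; it is treated as deletion of the spare
    variable. *)
Definition shrink x e L : {set {set T}} :=
  [set t in L | (if x is Some v then v \notin t else true) && (#|t| < e)%N].

Lemma pure_shrink x e L : (0 < e)%N -> pure_of_size L e -> pure_of_size (shrink x e L) e.-1.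
Proof.
move=> e0 pL; have [[L0 dL] ext] := pL; split.
  split=> [|s t]; first by rewrite inE L0 cards0 e0 andbT; case: x => // v; rewrite inE.
  rewrite !inE => /and3P[sL xs se] ts; rewrite (dL _ _ sL ts) /=.
  rewrite (leq_ltn_trans (subset_leq_card ts) se) andbT.
  by case: x xs => // v; apply: contra => /(subsetP ts).
move=> s; rewrite inE => /and3P[sL xs se]; have [F [FL sF Fe]] := ext _ sL.
(* w is the vertex to remove from F: the deleted point if F contains it, otherwise any vertex
   outside s. *)
have [w [wF ws xw]] : exists w, [/\ w \in F, w \notin s &
    if x is Some v then (v \in F) ==> (w == v) else true].
  have [w wF ws] : exists2 w, w \in F & w \notin s.
    by apply/subsetPn; apply: contraL se => /subset_leq_card; rewrite Fe -leqNgt.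
  case: x xs => [v|_]; last by exists w.
  by case: (boolP (v \in F)) => [vF vs|_ _]; [exists v; rewrite eqxx | exists w].
exists (F :\ w); split; last by have := cardsD1 w F; rewrite wF Fe add1n => ->.
  rewrite inE (dL _ _ FL (subsetDl _ _)) /=; have := cardsD1 w F; rewrite wF Fe add1n => ->.
  rewrite ltnSn andbT; case: x xw {xs} => // v; rewrite !inE.
  by case: (v \in F) => /=; rewrite ?andbF // => /eqP->; rewrite eqxx.
by rewrite subsetD1 sF.
Qed.

Lemma cohen_macaulay_shrink x e L : (0 < e)%N -> pure_of_size L e ->
  cohen_macaulay K L -> cohen_macaulay K (shrink x e L).
Proof.
move=> e0 pL cmL; have [cL ext] := pL; have [cC _] := pure_shrink x e0 pL.
have [pi [pi_surj pi_ker]] := sr_presentation K cL.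
have [pi' [pi_surj' pi_ker']] := sr_presentation K cC.
pose x' : 'I_#|T|.+1 := if x is Some v then emb v else ord_max.
have dL := downward_emb cL.
have x'mem s : (x' \in [set emb v | v in s]) = if x is Some v then v \in s else false.
  rewrite /x'; case: x {cC pi' pi_surj' pi_ker' x'} => [v|].
    by rewrite mem_imset //; apply: emb_inj.
  apply/negP => /imsetP[v _ /(congr1 val) /= e']; have := ltn_ord (enum_rank v).
  by rewrite -e' cardT -cardE ltnn.
have cardE s : #|[set emb v | v in s]| = #|s| by apply: card_imset; apply: emb_inj.
have Ce (s : {set 'I_#|T|.+1}) : s \in emb_complex L -> (#|s| <= e)%N.
  by move=> /imsetP[t tL ->]; rewrite cardE; apply: pure_of_size_le pL tL.
have CE : emb_complex (shrink x e L) = trim x' e (emb_complex L).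
  apply/setP => A; rewrite inE; apply/imsetP/and3P => [[t + ->]|[/imsetP[t tL ->] xt te]].
    rewrite inE => /and3P[tL xt te]; rewrite mem_emb_complex cardE x'mem.
    by split => //; case: x xt {cC pi' pi_surj' pi_ker' x' x'mem}.
  exists t => //; rewrite inE tL -cardE te andbT /=; move: xt; rewrite x'mem.
  by case: x {cC pi' pi_surj' pi_ker' x' x'mem}.
(* Purity provides F of size e around the support of the point, hence a regular sequence of full
   length e both at the origin (s empty) and at the vertex x. *)
have point pt s : s \in L -> (forall i, i \notin [set emb v | v in s] -> pt i = 0) ->
    exists a, [/\ regular_list (face_ideal (emb_complex L)) a, size a = e &
      forall p : {mpoly K[_]}, p \in a -> p.@[pt] = 0].
  move=> sL pt0; have [F [FL sF Fe]] := ext _ sL.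
  rewrite -Fe -cardE; apply: (regular_at_point pi_surj pi_ker dL) cmL.
    by rewrite mem_emb_complex.
  by move=> i iF; apply: pt0; apply: contra iF; apply/subsetP; rewrite emb_subset.
have ac d : acyclic (face_ideal (emb_complex (shrink x e L))) (params K x' e d) 1.
  have [a0 [ra sa a00]] := point (fun=> 0) set0 cL.1 (fun _ _ => erefl).
  rewrite CE; apply: (acyclic_trim (d := d) e0 dL Ce ra sa a00) => xL.
  have /imsetP[s sL xs] := xL; apply: (point _ s sL) => i; rewrite -xs inE.
  by case: eqP.
have noeth : noetherian (stanley_reisner_ring K (shrink x e L)).
  apply: noetherian_quotient pi_surj pi_surj' _ cmL.1 => p /pi_ker Lp; apply/pi_ker'.
  apply: face_ideal_subset Lp; apply: imsetS; apply/subsetP => t.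
  by rewrite inE => /andP[].
apply: (@acyclic_cohen_macaulay _ _ _ pi' pi_surj' (emb_complex (shrink x e L)) x' e.-1) => //.
- exact: downward_emb.
- move=> s /imsetP[t + ->]; by rewrite cardE inE => /and3P[_ _]; rewrite -{1}(prednK e0) ltnS.
Qed.

Definition prune (W : {set T}) k L : {set {set T}} :=
  [set t in L | [disjoint t & W] && (#|t| <= k)%N].

(** Lowering the skeleton by k takes k steps, each of which can delete one point of W; once W is
    exhausted, the remaining steps use [None]. *)
Lemma prune_induction (P : {set {set T}} -> nat -> Prop) :
  (forall x e L, (0 < e)%N -> P L e -> P (shrink x e L) e.-1) ->
  forall L e (W : {set T}) k, (#|W| <= k)%N -> (k <= e)%N ->
    (forall t, t \in L -> (#|t| <= e)%N) -> P L e -> P (prune W (e - k) L) (e - k)%N.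
Proof.
move=> step L e W k Wk; elim: k e L W Wk => [|k IH] e L W Wk ke Le PL.
  move: Wk; rewrite leqn0 cards_eq0 => /eqP->.
  rewrite subn0 [prune _ _ _](_ : _ = L) //; apply/setP => t; rewrite inE.
  rewrite -setI_eq0 setI0 eqxx; by case: (boolP (t \in L)) => //= /Le->.
have e0 : (0 < e)%N by apply: leq_trans ke.
pose x := [pick v in W]; pose W' := if x is Some v then W :\ v else W.
have W'k : (#|W'| <= k)%N.
  rewrite /W' /x; case: pickP => [v vW|W0]; first by move: Wk; rewrite (cardsD1 v) vW.
  by rewrite (_ : #|W| = 0)%N //; apply: eq_card0.
have -> : (e - k.+1 = e.-1 - k)%N by rewrite -subn1 -subnDA add1n.
have -> : prune W (e.-1 - k) L = prune W' (e.-1 - k) (shrink x e L).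
  apply/setP => t; rewrite !inE.
  have [tek|tek] := leqP #|t| (e.-1 - k); rewrite ?andbF // !andbT.
  have -> : (#|t| < e)%N by rewrite -(prednK e0) ltnS (leq_trans tek) ?leq_subr.
  rewrite andbT -andbA; congr (_ && _); rewrite /W' /x; case: pickP => [v vW|_] //=.
  rewrite -[in LHS](setD1K vW) -!setI_eq0 setIUr setU_eq0; congr (_ && _).
  by rewrite setI_eq0 disjoint_sym disjoints1.
apply: IH => //; [lia | | exact: step].
by move=> t; rewrite inE => /and3P[_ _]; rewrite -{1}(prednK e0) ltnS.
Qed.

Lemma cohen_macaulay_prune L e (W : {set T}) k : (#|W| <= k)%N -> (k <= e)%N ->
  pure_of_size L e -> cohen_macaulay K L -> cohen_macaulay K (prune W (e - k) L).
Proof.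
move=> Wk ke pL cL.
suff [] : pure_of_size (prune W (e - k) L) (e - k) /\ cohen_macaulay K (prune W (e - k) L) by [].
apply: (prune_induction (P := fun L e => pure_of_size L e /\ cohen_macaulay K L)) => //.
  move=> x e' L' e0 [pL' cL']; split; [exact: pure_shrink | exact: cohen_macaulay_shrink].
by move=> t; apply: pure_of_size_le.
Qed.

Lemma pure_prune L e (W : {set T}) k : (#|W| <= k)%N -> (k <= e)%N ->
  pure_of_size L e -> pure_of_size (prune W (e - k) L) (e - k).
Proof.
move=> Wk ke pL; apply: (prune_induction (P := pure_of_size)) => //.
  by move=> x e' L' e0; apply: pure_shrink.
by move=> t; apply: pure_of_size_le.
Qed.

Lemma card_complex_dim D e : pure_of_size D e -> complex_dim D = e%:Z - 1.
Proof.
move=> pD; rewrite /complex_dim; congr (Posz _ - 1).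
apply/eqP; rewrite eqn_leq; apply/andP; split.
  by apply/bigmax_leqP => s sD; apply: pure_of_size_le pD sD.
have [[D0 _] /(_ _ D0)[F [FD _ <-]]] := pD.
by apply: (bigmax_sup F).
Qed.

Lemma facet_card D e F : pure_of_size D e -> facet D F -> #|F| = e.
Proof.
move=> [_ ext] /maxsetP[FD Fmax]; have [G [GD FG <-]] := ext _ FD.
by rewrite (Fmax G).
Qed.

Lemma pure_of_sizeP D e : pure_of_size D e -> pure D.
Proof. by move=> pD F G FD GD; rewrite /face_dim (facet_card pD FD) (facet_card pD GD). Qed.

Lemma pure_pure_of_size D e : simplicial_complex D -> pure D ->
  complex_dim D = e%:Z - 1 -> pure_of_size D e.
Proof.
move=> cD pD dimD; split=> // s sD.
have [F facF sF] := maxset_exists (P := fun t => t \in D) sD.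
have [M [MD Me]] : exists M : {set T}, M \in D /\ #|M| = e.
  have [|M MD ME] := @eq_bigmax_cond _ (mem D) (fun t : {set T} => #|t|) _.
    by apply/card_gt0P; exists set0; case: cD.
  exists M; split => //; move: dimD => /eqP; rewrite /complex_dim (inj_eq (addIr _)).
  by rewrite ME eqz_nat => /eqP.
have [G facG MG] := maxset_exists (P := fun t => t \in D) MD.
have GD := maxsetp facG; exists F; split=> //; first exact: maxsetp facF.
have := pD _ _ facF facG; rewrite /face_dim => /eqP; rewrite (inj_eq (addIr _)) eqz_nat => /eqP->.
apply/eqP; rewrite eqn_leq -{2}Me (subset_leq_card MG) andbT.
have : (#|G| <= \max_(t in D) #|t|)%N by apply: (bigmax_sup G).
move: dimD => /eqP; rewrite /complex_dim (inj_eq (addIr _)) eqz_nat => /eqP->.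
by [].
Qed.

Lemma pure_link D e s : pure_of_size D e -> s \in D -> pure_of_size (link D s) (e - #|s|).
Proof.
move=> [[D0 dD] ext] sD; split.
  split=> [|t u]; first by rewrite inE D0 set0U sD set0I eqxx.
  rewrite !inE => /and3P[tD tsD /eqP ts0] ut; rewrite (dD _ _ tD ut) /=.
  rewrite (dD _ _ tsD (setSU _ ut)) /=; apply/eqP/setP => v; rewrite !inE.
  have /setP/(_ v) := ts0; rewrite !inE; case: (boolP (v \in u)) => //= /(subsetP ut)->.
  by [].
move=> t; rewrite inE => /and3P[tD tsD /eqP ts0]; have [F [FD tsF Fe]] := ext _ tsD.
have sF : s \subset F by apply: subset_trans tsF; apply: subsetUr.
exists (F :\: s); split.
- rewrite inE (dD _ _ FD (subsetDl _ _)) /= setDE setUIl setUC [~: s :|: s]setUC setUCr setIT.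
  by rewrite (setUidPr sF) FD /= -setIA [~: s :&: s]setIC setICr setI0.
- rewrite subsetD -setI_eq0 ts0 eqxx andbT; apply: subset_trans tsF; apply: subsetUl.
- by rewrite cardsD (setIidPr sF) Fe.
Qed.

End Shrink.

(** * Links of pruned complexes and the distribution of the deleted vertices *)

Lemma link_prune (T : finType) (D : {set {set T}}) (W s : {set T}) k : simplicial_complex D ->
  s \in prune W k D -> link (prune W k D) s = prune W (k - #|s|) (link D s).
Proof.
move=> [_ dD]; rewrite inE => /and3P[sD sW sk]; apply/setP => t; rewrite !inE.
have -> : [disjoint t :|: s & W] = [disjoint t & W].
  by rewrite -!setI_eq0 setIUl setU_eq0 [s :&: W == _]setI_eq0 sW andbT.
case: (boolP (t :&: s == set0)) => [/eqP ts0|_]; last by rewrite !andbF.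
rewrite !andbT cardsU ts0 cards0 subn0 leq_subRL // addnC.
case: (boolP (t :|: s \in D)) => tsD; rewrite /= ?andbF ?andbT //.
rewrite (dD _ _ tsD (subsetUl _ _)) /=; case: ([disjoint t & W]) => //=.
by apply: andb_idl; apply: leq_trans; apply: leq_addl.
Qed.

Theorem corollary3p10 (K : fieldType) (T : finType) (k t d s : nat)
    (Delta : {set {set T}}) :
  (0 < k)%N ->
  (t%:Z <= d%:Z - 1) ->
  kCMt_of_dim K k t (d%:Z - 1) Delta ->
  (s <= d)%N ->
  kCMt K (k + s) t (skeleton (d%:Z - s%:Z - 1) Delta).
Proof.
move=> k0 _ [cD HD] sd; have [D0 dD] := cD.
have memS (F : {set T}) :
    (F \in skeleton (d%:Z - s%:Z - 1) Delta) = (F \in Delta) && (#|F| <= d - s)%N.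
  by rewrite inE /face_dim; congr andb; lia.
set D' := skeleton _ _ in memS *; exists ((d - s)%N%:Z - 1); split.
  split=> [|F G]; rewrite !memS; first by rewrite D0 cards0.
  by move=> /andP[FD Fs] GF; rewrite (dD _ _ FD GF) (leq_trans (subset_leq_card GF)).
move=> W WV' Wks.
have V'V : vertices D' \subset vertices Delta.
  by apply/subsetP => v; rewrite inE memS => /andP[vD _]; rewrite inE.
(* The hypothesis on Delta takes care of at most k - 1 points of W; as W has at most k + s - 1, at
   most s remain for the skeleton steps. *)
have [W1 [W1W W1k W2s]] : exists W1 : {set T},
    [/\ W1 \subset W, (#|W1| < k)%N & (#|W :\: W1| <= s)%N].
  have : exists2 W1 : {set T}, W1 \subset W & #|W1| = minn #|W| k.-1.
    exists [set v in take k.-1 (enum W)].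
      by apply/subsetP => v; rewrite inE => /mem_take; rewrite mem_enum.
    rewrite cardsE (card_uniqP _) ?take_uniq ?enum_uniq //.
    by rewrite size_take_min -cardE minnC.
  move=> [W1 W1W W1E]; exists W1; split=> //; first by rewrite W1E; lia.
  rewrite cardsD (setIidPr W1W) W1E; lia.
have [[cD1 pD1 cmD1] dim1] := HD W1 (subset_trans W1W (subset_trans WV' V'V)) W1k.
set D1 := restriction Delta _ in cD1 pD1 cmD1 dim1.
have pd1 := pure_pure_of_size cD1 pD1 dim1.
set W2 := W :\: W1 in W2s.
(* [D'] can have fewer vertices than Delta (none if s = d), but the points of a face of [D'] are
   vertices of [D'], so either vertex set cuts out the same faces. *)
have -> : restriction D' (vertices D' :\: W) = prune W2 (d - s) D1.
  apply/setP => F; rewrite [LHS]inE memS [RHS]inE [F \in D1]inE.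
  case: (boolP (F \in Delta)) => //= FD; case: (leqP #|F| (d - s)) => Fds; last by rewrite !andbF.
  have vF : {subset F <= vertices D'}.
    move=> v vF; rewrite inE memS (dD _ _ FD) ?sub1set // cards1.
    by apply: leq_trans Fds; apply/card_gt0P; exists v.
  rewrite andbT !subsetD (introT subsetP vF) (subset_trans (introT subsetP vF) V'V) /=.
  rewrite -!setI_eq0 -setU_eq0 -setIUr /W2.
  by congr (_ :&: _ == _); apply/setP => v; rewrite !inE;
     case: (boolP (v \in W1)) => // /(subsetP W1W)->.
have pP := pure_prune W2s sd pd1.
split; last exact: card_complex_dim.
split; [exact: pP.1 | exact: pure_of_sizeP pP |].
move=> F FP tF; rewrite link_prune //.
move: (FP); rewrite inE => /and3P[FD1 _ Fds].
(* The link of F in D1 has facets of size d - #|F| and undergoes the same s steps as D1. *)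
have -> : (d - s - #|F| = d - #|F| - s)%N by rewrite subnAC.
apply: cohen_macaulay_prune => //; first by lia.
  exact: pure_link.
exact: cmD1.
Qed.
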